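(* Let $(\Omega,\mathcal{F},\mathbb{P})$ be a probability space with a filtration $(\mathcal{F}_n)_{n\ge 0}$, and let $f=(f_n)_{n\ge0}$ and $g=(g_n)_{n\ge0}$ be real-valued $(\mathcal{F}_n)$-martingales with difference sequences $df_0=f_0$, $df_n=f_n-f_{n-1}$, $dg_0=g_0$, $dg_n=g_n-g_{n-1}$ ($n\ge1$). Assume $f$ is non-negative and $g$ is differentially subordinate to $f$, i.e. $|dg_n|\le |df_n|$ almost surely for all $n\ge0$. Then $$\|g\|_{p,\infty}\le 2\|f\|_p \quad (0<p<1)$$ and $$\|g\|_{p,\infty}\le \frac{p}{2}(p-1)^{-1/p}\|f\|_p \quad (2\le p<\infty).$$ Both inequalities are sharp, i.e. the constants $2$ and $\frac p2(p-1)^{-1/p}$ cannot be replaced by smaller ones; they are already sharp in the class of pairs where $g$ is a transform of $f$, i.e. $dg_n=v_n\,df_n$ for a predictable real sequence $(v_n)$ with $|v_n|\le1$ a.s. ($v_n$ being $\mathcal{F}_{(n-1)\vee 0}$-measurable).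
   Context: For a martingale $f$ and $p\in(0,\infty)$: $\|f\|_p=\sup_n(\mathbb{E}|f_n|^p)^{1/p}$ and $\|f\|_{p,\infty}=\sup_{\lambda>0}\lambda\,(\mathbb{P}(f^*\ge\lambda))^{1/p}$, where $f^*=\sup_n|f_n|$. *)

(* Defs.v *)
From HB Require Import structures.
From mathcomp Require Import all_boot all_order all_algebra.
From mathcomp Require Import all_classical all_reals all_analysis.
Set Implicit Arguments. Unset Strict Implicit. Unset Printing Implicit Defensive.
Import Order.TTheory GRing.Theory Num.Theory.
Local Open Scope classical_set_scope.
Local Open Scope ring_scope.

Section martingales.
Context {d : measure_display} {T : measurableType d} {R : realType}.
Variable P : probability T R.

Definition filtration (F : nat -> set (set T)) : Prop :=
  (forall n, sigma_algebra setT (F n)) /\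
  (forall n, F n `<=` measurable) /\
  (forall n, F n `<=` F n.+1).

Definition measurable_wrt (G : set (set T)) (h : T -> R) : Prop :=
  forall B : set R, measurable B -> G (h @^-1` B).

(** Real-valued martingale w.r.t. (F_n): adapted, integrable, and
    E[f_{n+1} | F_n] = f_n, i.e. for every A in F_n,
    \int_A f_{n+1} dP = \int_A f_n dP. *)
Definition martingale (F : nat -> set (set T)) (f : nat -> T -> R) : Prop :=
  (forall n, measurable_wrt (F n) (f n)) /\
  (forall n, P.-integrable setT (EFin \o f n)) /\
  (forall n (A : set T), F n A ->
     (\int[P]_(x in A) (f n.+1 x)%:E = \int[P]_(x in A) (f n x)%:E)%E).

Definition diffseq (f : nat -> T -> R) (n : nat) (x : T) : R :=
  if n is m.+1 then f n x - f m x else f 0%N x.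

Definition maxfun (f : nat -> T -> R) (x : T) : \bar R :=
  ereal_sup (range (fun n => (`|f n x|)%:E)).

Definition mnorm (p : R) (f : nat -> T -> R) : \bar R :=
  ereal_sup (range (fun n =>
    ((\int[P]_x (`|f n x| `^ p)%:E) `^ p^-1)%E)).

Definition mweaknorm (p : R) (f : nat -> T -> R) : \bar R :=
  ereal_sup [set (l%:E * (P [set x | (l%:E <= maxfun f x)%E]) `^ p^-1)%E
            | l in [set l : R | 0 < l]].

Definition predictable (F : nat -> set (set T)) (v : nat -> T -> R) : Prop :=
  forall n, measurable_wrt (F n.-1) (v n).

End martingales.

(* Main.v *)
Require Import Defs.
From HB Require Import structures.
From mathcomp Require Import all_boot all_order all_algebra.
From mathcomp Require Import all_classical all_reals all_analysis measurable_realfun.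
From mathcomp Require Import zify ring lra.
Import Order.TTheory GRing.Theory Num.Theory.
Import numFieldNormedType.Exports.
Local Open Scope classical_set_scope.
Local Open Scope ring_scope.

(** Burkholder's method. For [2 <= p] put [gam = 1 - 2 / p] and, for [t > 0],
  [psi t x y = p^2/4 t^p ((y/t - gam)^2 - (x/t)^2 + 2 gam (x/t) / (p - 1))]
  with [y = |g|]. Each [psi t] is a quadratic form in [y^2 - x^2] plus affine
  terms and a concave kink at [y = 0], so a jump [(h, k)] with [|k| <= |h|] never
  takes it above its tangent plane. Moreover
  [d psi / dt = const * t^(p - 3) (t - (x + y)) (gam t - (y - x))], so the choice
  [tau = min (1, max (x + y, (y - x) / gam))] minimizes [psi] over the parameters
  that are reachable: a jump with [|k| <= |h|] cannot increase [x + y] and [y - x]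
  simultaneously. Hence [usp = psi tau] decreases in mean along [(f, g)]; it
  dominates [1_{|y| >= 1} - K x^p] with [K = (p/2)^p / (p - 1)], and is nonpositive
  where [|y| <= x], which gives [P (g* >= 1) <= K E f^p]. For [p < 1] the same scheme
  with [wsp x y = 2 x + y^2 - x^2] (capped at 1) gives [P (g* >= 1) <= E (2 f_0)^p].

  Extremal pairs are chains killed at a random time. For [p < 1] two fair steps
  starting from [f_0 = g_0 = 1/2] suffice. For [p >= 2] the pair climbs along the
  ray [y = (p - 1) x]: a step of slope [1] that either goes slightly up or dies at
  [x = 0], then a step of slope [-1] that returns to the ray or stops where the
  tangent from [(0, x + y)] touches [- K x^p]. *)

(** * The special function for large exponents *)

(** Young's inequality for the product [w * 1] with exponents [p] and [p / (p - 1)], multiplied by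
    [p]. *)
Lemma bernoulli_powR {R : realType} (p w : R) : 1 <= p -> 0 <= w ->
  1 + p * (w - 1) <= w `^ p.
Proof.
move=> p1 w0; have p_gt0 : 0 < p by lra.
have [->|pn1] := eqVneq p 1; first by rewrite powRr1//; lra.
have p1' : 1 < p by rewrite lt_neqAle eq_sym pn1.
have q0 : 0 < p / (p - 1) by rewrite divr_gt0// subr_gt0.
have /(_ _)/= := @conjugate_powR R w 1 p (p / (p - 1)) w0 ler01 p_gt0 q0.
rewrite mulr1 powR1 invf_div => /(_ _)-H.
have : w <= w `^ p / p + (p - 1) / p.
  by rewrite -[X in _ + X]mul1r; apply: H; field; lra.
rewrite -mulrDl ler_pdivlMr//; lra.
Qed.

Section burkholder_function.
Context {R : realType}.
Variable p : R.
Hypothesis p2 : 2 <= p.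

Definition gam : R := 1 - 2 / p.

(** Expanded so that nothing is divided by [t]: this also gives a value at [t = 0], the parameter
    that [tau] selects at the origin. *)
Definition psi (t x y : R) : R := p ^+ 2 / 4 *
  (t `^ (p - 2) * (y ^+ 2 - x ^+ 2)
   - 2 * gam * t `^ (p - 1) * (y - x / (p - 1)) + gam ^+ 2 * t `^ p).

(* For [p = 2] one has [gam = 0]: then [psi] does not depend on [t > 0] and the
   junk value [(y - x) / 0 = 0] is harmless. *)
Definition tau (x y : R) : R := Num.min 1 (Num.max (x + y) ((y - x) / gam)).

Let p_gt0 : 0 < p. Proof. exact: lt_le_trans p2. Qed.
Let p_neq0 : p != 0. Proof. by rewrite gt_eqF. Qed.
Let p1_neq0 : p - 1 != 0. Proof. by rewrite gt_eqF// subr_gt0 (lt_le_trans _ p2)// ltr1n. Qed.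

Let gam_ge0 : 0 <= gam.
Proof. by rewrite subr_ge0 ler_pdivrMr ?mul1r. Qed.

Let gam_lt1 : gam < 1.
Proof. by rewrite /gam gtrBl divr_gt0. Qed.

Let powRS (t r : R) : 0 < t -> t `^ (r + 1) = t `^ r * t.
Proof. by move=> t0; rewrite powRD ?powRr1 ?ltW// (gt_eqF t0) implybT. Qed.

Let powRp1 (t : R) : 0 < t -> t `^ (p - 1) = t `^ (p - 2) * t.
Proof. by move=> t0; rewrite -powRS//; congr (_ `^ _); ring. Qed.

Let powRp (t : R) : 0 < t -> t `^ p = t `^ (p - 2) * t * t.
Proof. by move=> t0; rewrite -!powRS//; congr (_ `^ _); ring. Qed.

(** The quadratic factor splits because [p - 2 = p * gam]; its roots in [t] are [x + y] and
    [(y - x) / gam]. *)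
Let dpsi (t x y : R) : R :=
  p ^+ 3 / 4 * t `^ (p - 3) * (gam * ((t - (x + y)) * (gam * t - (y - x)))).

Lemma is_derive_psi (x y t : R) : 0 < t ->
  is_derive t 1 (fun u => psi u x y) (dpsi t x y).
Proof.
move=> t0; rewrite /psi.
have D r := @is_derive1_powR R r t t0.
apply: is_derive_eq.
rewrite /dpsi.
rewrite !scaler0 ?addr0 ?add0r.
have -> : p - 1 - 1 = (p - 3) + 1 by ring.
have -> : p - 2 - 1 = p - 3 by ring.
have -> : p - 1 = (p - 3) + 1 + 1 by ring.
rewrite !powRS//.
rewrite /GRing.scale/= /gam.
field.
by rewrite p_neq0 (_ : p - 3 + 1 + 1 = p - 1)//; ring.
Qed.

Lemma psi_nonincreasing (x y t u : R) : 0 < t -> t <= u ->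
  (forall v, t < v < u -> gam * ((v - (x + y)) * (gam * v - (y - x))) <= 0) ->
  psi u x y <= psi t x y.
Proof.
move=> t0 tu H; have pos v : v \in `]t, u[ -> 0 < v.
  by rewrite in_itv => /andP[/(lt_trans t0)].
refine (@ler0_derive1_nincr _ (fun v => psi v x y) t u _ _ _ t u (lexx t) tu (lexx u)).
- by move=> v /pos v0; case: (is_derive_psi x y v v0).
- move=> v vtu; have v0 := pos _ vtu.
  rewrite derive1E; case: (is_derive_psi x y v v0) => _ ->; rewrite /dpsi.
  apply: mulr_ge0_le0; last by apply: H; rewrite in_itv in vtu.
  by rewrite mulr_ge0 ?powR_ge0// divr_ge0 ?exprn_ge0// ltW.
- apply: derivable_within_continuous => v; rewrite in_itv/= => /andP[tv _].
  by case: (is_derive_psi x y v (lt_le_trans t0 tv)).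
Qed.

Lemma psi_nondecreasing (x y t u : R) : 0 < t -> t <= u ->
  (forall v, t < v < u -> 0 <= gam * ((v - (x + y)) * (gam * v - (y - x)))) ->
  psi t x y <= psi u x y.
Proof.
move=> t0 tu H; have pos v : v \in `]t, u[ -> 0 < v.
  by rewrite in_itv => /andP[/(lt_trans t0)].
refine (@ger0_derive1_ndecr _ (fun v => psi v x y) t u _ _ _ t u (lexx t) tu (lexx u)).
- by move=> v /pos v0; case: (is_derive_psi x y v v0).
- move=> v vtu; have v0 := pos _ vtu.
  rewrite derive1E; case: (is_derive_psi x y v v0) => _ ->; rewrite /dpsi.
  apply: mulr_ge0; last by apply: H; rewrite in_itv in vtu.
  by rewrite mulr_ge0 ?powR_ge0// divr_ge0 ?exprn_ge0// ltW.
- apply: derivable_within_continuous => v; rewrite in_itv/= => /andP[tv _].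
  by case: (is_derive_psi x y v (lt_le_trans t0 tv)).
Qed.

Let powR_p0 : 0 `^ p = 0 :> R. Proof. by rewrite powR0. Qed.
Let powR_p10 : 0 `^ (p - 1) = 0 :> R. Proof. by rewrite powR0. Qed.

Lemma psi00 t : psi t 0 0 = p ^+ 2 / 4 * gam ^+ 2 * t `^ p.
Proof. by rewrite /psi; ring. Qed.

Lemma tau00 : tau 0 0 = 0.
Proof. by rewrite /tau subr0 addr0 mul0r maxxx min_r. Qed.

Lemma tau_le1 x y : tau x y <= 1.
Proof. by rewrite ge_min lexx. Qed.

Lemma tau_gt0 x y : 0 < x + y -> 0 < tau x y.
Proof. by move=> xy0; rewrite lt_min ltr01 lt_max xy0. Qed.

(** In [t], [psi] decreases between the two roots of [dpsi] and increases above the larger one, and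
    [tau] is that larger root capped at 1. A parameter that is at least one of the roots is
    therefore never better than [tau]. Below both roots [psi] increases again, which is why a
    condition on [t] appears. *)
Lemma psi_tau_le t x y : 0 < t <= 1 -> 0 <= x -> 0 <= y ->
  [\/ t = 1, gam = 0, x + y <= t | y - x <= gam * t] ->
  psi (tau x y) x y <= psi t x y.
Proof.
move=> /andP[t0 t1] x0 y0 H.
have [xy0|xyn0] := eqVneq (x + y) 0.
  have -> : x = 0 by lra.
  have -> : y = 0 by lra.
  rewrite tau00 !psi00 powR_p0 mulr0 mulr_ge0 ?powR_ge0//.
  by rewrite mulr_ge0 ?sqr_ge0// divr_ge0 ?sqr_ge0.
have xy_gt0 : 0 < x + y by rewrite lt_neqAle eq_sym xyn0 addr_ge0.
have T0 := tau_gt0 _ _ xy_gt0.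
have [tT|Tt] := leP t (tau x y).
  apply: psi_nonincreasing => // v /andP[tv].
  rewrite lt_min lt_max => /andP[v1].
  have [->|gam_neq0] := eqVneq gam 0; first by rewrite !mul0r.
  have gam_gt0 : 0 < gam by rewrite lt_neqAle eq_sym gam_neq0 gam_ge0.
  rewrite ltr_pdivlMr// => Hv.
  rewrite mulr_ge0_le0//.
  case: H Hv => H.
  - by move: tv; rewrite H; lra.
  - by rewrite H eqxx in gam_neq0.
  - by case/orP => Hv; [lra|rewrite mulr_ge0_le0//; lra].
  - have gtv : gam * t <= gam * v by rewrite ler_wpM2l// ltW.
    by case/orP => Hv; [rewrite mulr_le0_ge0//; lra|nra].
apply: psi_nondecreasing => //; first exact: ltW.
move=> v /andP[+ vt].
have v1 : v < 1 by exact: lt_le_trans t1.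
rewrite gt_min ltNge (ltW v1)/= gt_max => /andP[sv].
have [->|gam_neq0] := eqVneq gam 0; first by rewrite !mul0r.
have gam_gt0 : 0 < gam by rewrite lt_neqAle eq_sym gam_neq0 gam_ge0.
by rewrite ltr_pdivrMr// => dv; rewrite !mulr_ge0//; lra.
Qed.

(** On the line [x + y = s], the function [psi s] is affine in [x], with slope
    [- aspec * s ^ (p - 1)]. *)
Definition aspec : R := p ^+ 2 / (2 * (p - 1)).
(** The [p]-th power of the weak-type constant for [2 <= p]. *)
Definition kspec : R := (p / 2) `^ p / (p - 1).
Definition usp (x y : R) : R := psi (tau x `|y|) x `|y|.
Definition usp_x (x y : R) : R := p ^+ 2 / 4 *
  (2 * gam * tau x `|y| `^ (p - 1) / (p - 1) - 2 * tau x `|y| `^ (p - 2) * x).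
Definition usp_y (x y : R) : R := p ^+ 2 / 4 *
  (2 * tau x `|y| `^ (p - 2) * y - 2 * gam * tau x `|y| `^ (p - 1) * Num.sg y).

Let p1_gt0 : 0 < p - 1.
Proof. by rewrite subr_gt0 (lt_le_trans _ p2)// ltr1n. Qed.

Let pp4_ge0 : 0 <= p ^+ 2 / 4.
Proof. by rewrite divr_ge0 ?sqr_ge0. Qed.

(** Up to the factor [p^2 / 4], the two sides differ by [t^(p - 2) (h^2 - k^2)] plus
    [2 gam t^(p - 1)] times the convexity gap of the absolute value between [y] and [y + k]; both
    are nonnegative. *)
Lemma psi_step (t x y h k : R) : `|k| <= `|h| ->
  psi t (x + h) `|y + k| <= psi t x `|y| + p ^+ 2 / 4 *
    ((2 * gam * t `^ (p - 1) / (p - 1) - 2 * t `^ (p - 2) * x) * h +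
     (2 * t `^ (p - 2) * y - 2 * gam * t `^ (p - 1) * Num.sg y) * k).
Proof.
move=> kh; rewrite /psi -mulrDr ler_wpM2l// !real_normK ?num_real//.
have sgk : `|y| + Num.sg y * k <= `|y + k|.
  have [->|y0] := eqVneq y 0; first by rewrite sgr0 mul0r normr0 !add0r.
  rewrite (_ : `|y| + _ = Num.sg y * (y + k)); last first.
    by rewrite mulrDr -normrEsg.
  by rewrite (le_trans (ler_norm _))// normrM normr_sg y0 mul1r.
have kh2 : k ^+ 2 <= h ^+ 2.
  by rewrite -(real_normK (num_real k)) -(real_normK (num_real h)) ler_pXn2r ?nnegrE.
have [a0 b0] : 0 <= t `^ (p - 2) /\ 0 <= gam * t `^ (p - 1).
  by split; [exact: powR_ge0|rewrite mulr_ge0 ?powR_ge0].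
rewrite -subr_ge0.
set a := t `^ (p - 2) in a0 *; set b := t `^ (p - 1) in b0 *.
rewrite (_ : _ - _ = a * (h ^+ 2 - k ^+ 2)
  + 2 * (gam * b) * (`|y + k| - (`|y| + Num.sg y * k))); last by ring.
by apply: addr_ge0; apply: mulr_ge0; rewrite ?subr_ge0// mulr_ge0.
Qed.

Lemma psi_at_sum (x y : R) : 0 < x + y ->
  psi (x + y) x y = (x + y) `^ (p - 1) * (x + y - aspec * x).
Proof.
move=> s0; rewrite /psi.
rewrite powRp// powRp1// /aspec /gam; field.
by rewrite p_neq0 p1_neq0.
Qed.

Let kspec_powR (x : R) : 0 <= x -> kspec * x `^ p = (p / 2 * x) `^ p / (p - 1).
Proof.
by move=> x0; rewrite powRM ?divr_ge0 ?(ltW p_gt0)// /kspec mulrAC.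
Qed.

(* The line through [(s, 0)] tangent to [- K x ^ p] touches it at [x = 2 s / p]. *)
Lemma kspec_tangent (s x : R) : 0 < s -> 0 <= x ->
  - (kspec * x `^ p) <= s `^ (p - 1) * (s - aspec * x).
Proof.
(* [w] is the ratio of [x] to the point of tangency; the claim is then Bernoulli's inequality at
   [w]. *)
move=> s0 x0; pose w := p / 2 * x / s.
have w0 : 0 <= w by rewrite divr_ge0 ?(ltW s0)// mulr_ge0// divr_ge0// ltW.
have p1 : 1 <= p by rewrite (le_trans _ p2)// ler1n.
have := bernoulli_powR p w p1 w0.
have -> : kspec * x `^ p = s `^ (p - 1) * s * (w `^ p / (p - 1)).
  rewrite kspec_powR// (_ : p / 2 * x = s * w); last by rewrite /w; field; rewrite gt_eqF.
  by rewrite powRM ?(ltW s0)// mulrA [s `^ _ * s]mulrC mulr_powRB1// ltW.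
move=> H; rewrite -mulrN -mulrA ler_wpM2l ?powR_ge0//.
rewrite -mulrN -subr_ge0.
rewrite (_ : _ - _ = s * ((w `^ p - (1 + p * (w - 1))) / (p - 1))).
  by rewrite mulr_ge0 ?(ltW s0)// divr_ge0 ?(ltW p1_gt0)// subr_ge0.
by rewrite /w /aspec; field; rewrite p1_neq0 gt_eqF.
Qed.

Lemma psi_ge0 (t x y : R) : 0 < t -> 0 <= x -> gam * t <= y - x ->
  0 <= psi t x y.
Proof.
move=> t0 x0 d0; rewrite /psi mulr_ge0//.
rewrite powRp// powRp1//.
have gt0 : 0 <= gam * t by rewrite mulr_ge0// ltW.
set u := t `^ _.
rewrite (_ : _ + _ = u * ((y - gam * t) ^+ 2 - x ^+ 2
    + 2 * (gam * t) * (x / (p - 1)))); last by ring.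
apply: mulr_ge0; [exact: powR_ge0|apply: addr_ge0].
  by rewrite subr_ge0 ler_pXn2r ?nnegrE//; lra.
by apply: mulr_ge0; [exact: mulr_ge0|rewrite divr_ge0// ltW].
Qed.

(** If [|y| - x >= gam * tau], then [psi] is nonnegative. Otherwise [tau <= x + |y|] and [psi]
    decreases between these two parameters, so its value at [tau] is at least the affine expression
    at [x + |y|], which lies above [- kspec * x ^ p] by tangency. *)
Lemma usp_ge (x y : R) : 0 <= x -> - (kspec * x `^ p) <= usp x y.
Proof.
move=> x0; rewrite /usp; set Y := `|y|; have Y0 : 0 <= Y by exact: normr_ge0.
have [xy0|xyn0] := eqVneq (x + Y) 0.
  have -> : x = 0 by lra.
  have -> : Y = 0 by lra.
  by rewrite tau00 psi00 powR_p0 !mulr0 oppr0.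
have xy_gt0 : 0 < x + Y by rewrite lt_neqAle eq_sym xyn0 addr_ge0.
have T0 := tau_gt0 _ _ xy_gt0.
have K0 : - (kspec * x `^ p) <= 0.
  by rewrite oppr_le0 mulr_ge0 ?powR_ge0// divr_ge0 ?powR_ge0// ltW.
have [d0|d0] := leP (gam * tau x Y) (Y - x).
  by apply: (le_trans K0); exact: psi_ge0.
rewrite (le_trans (kspec_tangent _ _ xy_gt0 x0))// -psi_at_sum//.
have Ts : tau x Y <= x + Y.
  rewrite /tau in d0; rewrite /tau ge_min ge_max lexx/=.
  have [//|s1/=] := leP 1 (x + Y).
  have [g0|gam_neq0] := eqVneq gam 0; first by rewrite g0 invr0 mulr0 ltW.
  have gam_gt0 : 0 < gam by rewrite lt_neqAle eq_sym gam_neq0 gam_ge0.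
  have [//|sd] := leP ((Y - x) / gam) (x + Y).
  exfalso; move: d0; rewrite ltNge => /negP; apply.
  by rewrite mulrC -ler_pdivlMr// ge_min (max_r (ltW sd)) lexx orbT.
apply: psi_nonincreasing => // v /andP[Tv vs].
apply: mulr_ge0_le0 => //; apply: mulr_le0_ge0; first by rewrite subr_le0 ltW.
by rewrite subr_ge0 (le_trans (ltW d0))// ler_wpM2l// ltW.
Qed.

(** Here [tau = 1] and, since [gam < 1], the worst case is [|y| = 1]. What remains is Bernoulli's
    inequality at [p / 2 * x] with exponent [p - 1], which is at least 1 because [2 <= p]. *)
Lemma usp_ge1 (x y : R) : 0 <= x -> 1 <= `|y| -> 1 - kspec * x `^ p <= usp x y.
Proof.
move=> x0; rewrite /usp; set Y := `|y| => Y1.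
have -> : tau x Y = 1 by rewrite /tau min_l// le_max -[1]add0r lerD.
rewrite /psi !powR1.
have w0 : 0 <= p / 2 * x by rewrite mulr_ge0// divr_ge0// ltW.
have p11 : 1 <= p - 1 by have := p2; lra.
have H := bernoulli_powR (p - 1) (p / 2 * x) p11 w0.
rewrite kspec_powR// -subr_ge0.
have Yg : (1 - gam) ^+ 2 <= (Y - gam) ^+ 2
  by rewrite ler_sqr ?nnegrE ?subr_ge0 ?lerD2r// ?(le_trans _ Y1)// ltW.
have := mulr_powRB1 w0 p_gt0; set w := p / 2 * x in H w0 *; set W := w `^ _ in H * => <-.
rewrite (_ : _ - _ = p ^+ 2 / 4 * ((Y - gam) ^+ 2 - (1 - gam) ^+ 2)
   + w * (W - (1 + (p - 1) * (w - 1))) / (p - 1)); last first.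
  by rewrite /w /gam; field; rewrite p_neq0 p1_neq0.
apply: addr_ge0; first by apply: mulr_ge0; rewrite ?subr_ge0.
by apply: divr_ge0; [apply: mulr_ge0; rewrite ?subr_ge0|exact: ltW].
Qed.

(** When [|y| <= x], every [t] in []0, 1]] may be compared with [tau]. For such [t], the powers
    [t ^ (p - 1)] and [t ^ p] are at most [t] and the term in [y^2 - x^2] is nonpositive, so [psi t]
    is at most [C * t]; letting [t] tend to 0 gives the sign. *)
Lemma usp_init (x y : R) : `|y| <= x -> usp x y <= 0.
Proof.
move=> yx; have x0 : 0 <= x by exact: le_trans (normr_ge0 _) yx.
have p2' := p2; have g1 := gam_lt1; have g0 := gam_ge0; pose C := p ^+ 2 / 4 * (2 * x + 1).
have C0 : 0 < C by rewrite mulr_gt0 ?divr_gt0 ?exprn_gt0//; lra.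
have UC t : 0 < t <= 1 -> usp x y <= C * t.
  move=> /[dup] t01 /andP[t0 t1].
  have : usp x y <= psi t x `|y|.
    apply: psi_tau_le => //; apply: Or44.
    by rewrite (@le_trans _ _ 0) ?subr_le0// mulr_ge0// ltW.
  move=> /le_trans; apply; rewrite /C /psi -[leRHS]mulrA ler_wpM2l//.
  have A1 : t `^ (p - 1) <= t.
    by rewrite ge1r_powR ?t0//; lra.
  have A2 : t `^ p <= t by rewrite ge1r_powR ?t0//; lra.
  have B0 : t `^ (p - 2) * (`|y| ^+ 2 - x ^+ 2) <= 0.
    by rewrite mulr_ge0_le0 ?powR_ge0// subr_le0 ler_pXn2r ?nnegrE.
  have B1 : gam ^+ 2 * t `^ p <= t.
    by rewrite -[leRHS]mul1r ler_pM ?sqr_ge0 ?powR_ge0// expr_le1// ltW.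
  have B2 : - (2 * gam * t `^ (p - 1) * (`|y| - x / (p - 1))) <= 2 * x * t.
    rewrite -mulrN.
    have D : - (`|y| - x / (p - 1)) <= x.
      rewrite opprB lerBlDr (@le_trans _ _ x) ?lerDl//.
      by rewrite ler_pdivrMr// ler_peMr//; lra.
    have D0 : 0 <= gam * t `^ (p - 1) by rewrite mulr_ge0 ?powR_ge0.
    have D1 : gam * t `^ (p - 1) <= t.
      by rewrite -[leRHS]mul1r ler_pM ?powR_ge0// ltW.
    rewrite -!mulrA ler_wpM2l// mulrA.
    rewrite (@le_trans _ _ (gam * t `^ (p - 1) * x))//; first by rewrite ler_wpM2l.
    by rewrite [leRHS]mulrC ler_wpM2r.
  lra.
rewrite leNgt; apply/negP => U0.
(* If [usp x y] were positive, this [t] would make [C * t] at most half of it. *)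
pose t := Num.min 1 (usp x y / (2 * C)).
have t0 : 0 < t by rewrite lt_min ltr01 divr_gt0// mulr_gt0.
have := UC t; rewrite t0 ge_min lexx => /(_ isT).
have : C * t <= usp x y / 2.
  rewrite (@le_trans _ _ (C * (usp x y / (2 * C))))//.
    by rewrite ler_pM2l// ge_min lexx orbT.
  by rewrite le_eqVlt; apply/orP; left; apply/eqP; field; rewrite gt_eqF.
lra.
Qed.

(** The jump is first made with the parameter frozen at the old [tau], where the tangent bound
    holds; then the parameter is re-optimized at the new point, which only lowers the value. *)
Lemma usp_step (x y h k : R) : 0 <= x -> 0 <= x + h -> `|k| <= `|h| ->
  usp (x + h) (y + k) <= usp x y + usp_x x y * h + usp_y x y * k.
Proof.
move=> x0 xh0 kh.
(* At the origin [tau = 0], where [psi] has no usable derivative in [t]. Both slopes vanish there,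
   and the new point satisfies [|k| <= h], so the initial sign applies. *)
have [xy0|xyn0] := eqVneq (x + `|y|) 0.
  have xE : x = 0 by have := normr_ge0 y; lra.
  have y0 : `|y| = 0 by lra.
  have yE : y = 0 by apply/normr0_eq0.
  rewrite /usp_x /usp_y xE yE normr0 tau00 powR_p10 !(mulr0, mul0r, subr0, addr0).
  rewrite [usp 0 0]/usp normr0 tau00 psi00 powR_p0 mulr0 !add0r.
  by apply: usp_init; rewrite (le_trans kh)// ger0_norm//; lra.
have xy_gt0 : 0 < x + `|y| by rewrite lt_neqAle eq_sym xyn0 addr_ge0.
have T0 := tau_gt0 _ _ xy_gt0.
apply: (@le_trans _ _ (psi (tau x `|y|) (x + h) `|y + k|)); last first.
  apply: (le_trans (psi_step _ _ _ _ _ kh)).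
  by rewrite /usp /usp_x /usp_y -addrA lerD2l le_eqVlt; apply/orP; left; apply/eqP; ring.
apply: psi_tau_le => //; first by rewrite T0 tau_le1.
set t := tau _ _.
have [->|t1] := eqVneq t 1; first exact: Or41.
have [->|gam_neq0] := eqVneq gam 0; first exact: Or42.
have gam_gt0 : 0 < gam by rewrite lt_neqAle eq_sym gam_neq0 gam_ge0.
have [|tS] := leP (x + h + `|y + k|) t; first by move=> ?; exact: Or43.
apply: Or44; rewrite leNgt; apply/negP => tD.
have tE : t = Num.max (x + `|y|) ((`|y| - x) / gam).
  rewrite /t /tau min_r// leNgt; apply/negP => m1.
  by move: t1; rewrite /t /tau (min_l (ltW m1)) eqxx.
have st : x + `|y| <= t by rewrite tE le_max lexx.
have dt : `|y| - x <= gam * t by rewrite -ler_pdivrMl// mulrC tE le_max lexx orbT.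
have := ler_normD y k.
(* For [h >= 0] the difference [|y| - x] cannot grow; for [h < 0] the sum [x + |y|] cannot grow.
   Hence the old [tau] stays above at least one root. *)
by have [h0|h0] := leP 0 h; move: kh; [rewrite (ger0_norm h0)|rewrite (ltr0_norm h0)]; lra.
Qed.

(** Comparison with [t = 1]; this provides an integrable majorant before the level is reached. *)
Lemma usp_le (x y : R) : 0 <= x -> `|y| <= 1 ->
  usp x y <= p ^+ 2 / 4 * (3 + 2 * x `^ p).
Proof.
move=> x0 y1; apply: (@le_trans _ _ (psi 1 x `|y|)).
  by apply: psi_tau_le => //; [rewrite ltr01 lexx|exact: Or41].
rewrite /psi !powR1 ler_wpM2l//.
have p2' := p2; have g1 := gam_lt1; have g0 := gam_ge0.
have xp : x <= 1 + x `^ p.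
  have p1 : 1 <= p by lra.
  have H := bernoulli_powR p x p1 x0.
  have [x1|x1] := leP x 1; first by have := powR_ge0 x p; lra.
  have x1' : 0 <= x - 1 by lra.
  by have := ler_wpM2r x1' p1; lra.
have Yg : (`|y| - gam) ^+ 2 <= 1.
  by have := normr_ge0 y; nra.
have gx : gam * (x / (p - 1)) <= x.
  have D : x / (p - 1) <= x by rewrite ler_pdivrMr// ler_peMr//; lra.
  have D0 : 0 <= x / (p - 1) by rewrite divr_ge0// ltW.
  nra.
nra.
Qed.
End burkholder_function.

(** * Integrals against bounded predictable multipliers *)

Section martingale_tools.
Context {d : measure_display} {T : measurableType d} {R : realType}.
Variable P : probability T R.

Local Notation L1 h := (P.-integrable setT (EFin \o h)).

(** Makes the closure properties of measurable functions available for each sigma-algebra of the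
    filtration. *)
Lemma measurable_wrtP (G : set (set T)) (h : T -> R) : sigma_algebra setT G ->
  measurable_wrt G h <-> measurable_fun [set: g_sigma_algebraType G] h.
Proof.
move=> sG.
have mG A : @measurable _ (g_sigma_algebraType G) A <-> G A.
  by rewrite -[X in _ <-> X A](sigma_algebra_id sG).
split=> [mh _ B mB|mh B mB]; first by rewrite setTI; apply/mG; exact: mh.
by apply/mG; rewrite -[_ @^-1` _]setTI; exact: mh.
Qed.

Lemma L1D (h1 h2 : T -> R) : L1 h1 -> L1 h2 -> L1 (fun x => h1 x + h2 x).
Proof. by move=> i1 i2; exact: (integrableD measurableT i1 i2). Qed.

Lemma L1B (h1 h2 : T -> R) : L1 h1 -> L1 h2 -> L1 (fun x => h1 x - h2 x).
Proof. by move=> i1 i2; exact: (integrableB measurableT i1 i2). Qed.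

Lemma L1Z k (h : T -> R) : L1 h -> L1 (fun x => k * h x).
Proof. by move=> ih; exact: (integrableZl measurableT k ih). Qed.

Lemma ae_Rintegral_ge0 (h : T -> R) : L1 h -> {ae P, forall x, 0 <= h x} ->
  0 <= \int[P]_x h x.
Proof.
move=> ih h0; have mh := measurable_int _ ih.
rewrite /Rintegral.
rewrite (@ae_eq_integral _ _ _ _ setT (fun x => `|(h x)%:E|)%E)//.
- by rewrite fine_ge0// integral_ge0.
- exact: measurableT_comp.
- by apply: filterS h0 => x hx _; rewrite gee0_abs.
Qed.

Lemma ae_le_Rintegral (h1 h2 : T -> R) : L1 h1 -> L1 h2 ->
  {ae P, forall x, h1 x <= h2 x} -> \int[P]_x h1 x <= \int[P]_x h2 x.
Proof.
move=> i1 i2 h12; rewrite -subr_ge0 -RintegralB//; apply: ae_Rintegral_ge0.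
  exact: L1B.
by apply: filterS h12 => x; rewrite subr_ge0.
Qed.

Lemma bounded_mul_integrable (phi h : T -> R) (M : R) :
  measurable_fun setT phi -> (forall x, `|phi x| <= M) -> L1 h ->
  L1 (fun x => phi x * h x).
Proof.
move=> mphi bphi ih.
have -> : EFin \o (fun x => phi x * h x) = ((EFin \o phi) \* (EFin \o h))%E.
  by apply/funext => x /=; rewrite EFinM.
apply: integrableMr => //.
exists M; split=> [|N MN x _]; first exact: num_real.
by apply: le_trans (bphi x) _; exact: ltW.
Qed.

(* [steps m u] is the minimum of [m] and the integer part of [u]; thus
   [steps m (k * phi) / k] is a combination of indicators uniformly close to [phi]. *)
Let steps (m : nat) (u : R) : R := \sum_(j < m) (nat_of_bool (j.+1%:R <= u)%R)%:R.

Let steps_approx m u : 0 <= u ->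
  (m%:R <= u -> steps m u = m%:R) /\ (u <= m%:R -> u - 1 <= steps m u <= u).
Proof.
move=> u0; elim: m => [|m [IH1 IH2]]; rewrite /steps.
  by rewrite big_ord0; split=> // u0'; apply/andP; split; lra.
rewrite big_ord_recr/= -/(steps m u); split => H.
  by rewrite H IH1 ?natr1// (le_trans _ H)// ler_nat.
have [mu|um] := leP m.+1%:R u.
  rewrite -natr1 in H mu; rewrite IH1/=; first by apply/andP; split; lra.
  by lra.
rewrite addr0.
have [/IH2//|mu] := leP u m%:R.
rewrite -natr1 in um; rewrite IH1 ?(ltW mu)//; apply/andP; split; lra.
Qed.

(** * Martingale increments integrate to zero against bounded functions of the past *)

Section orthogonality.
Variables (F : nat -> set (set T)) (f : nat -> T -> R) (n : nat).
Hypothesis (FF : filtration F) (Mf : martingale P F f).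

Let D x := f n.+1 x - f n x.

Lemma filtration_measurable (h : T -> R) k : measurable_wrt (F k) h -> measurable_fun setT h.
Proof. by move=> mh _ B mB; rewrite setTI; apply: (FF.2.1 k); exact: mh. Qed.

Let iD : L1 D.
Proof. by apply: L1B; exact: Mf.2.1. Qed.

Let int_indic A : F n A -> \int[P]_x (\1_A x * D x) = 0.
Proof.
move=> FA; have mA : measurable A by exact: (FF.2.1 n).
have -> : \int[P]_x (\1_A x * D x) = \int[P]_(x in A) D x.
  rewrite [RHS]Rintegral_mkcond; apply: eq_Rintegral => x _.
  rewrite patchE indicE; case: ifPn => _; rewrite ?mul1r ?mul0r//.
rewrite RintegralB//; [|by apply: integrableS (Mf.2.1 _)..].
by rewrite /Rintegral (Mf.2.2 n A FA) subrr.
Qed.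

Let sF_set (phi : T -> R) r : measurable_wrt (F n) phi -> F n [set x | r <= phi x].
Proof.
move=> mphi; have -> : [set x | r <= phi x] = phi @^-1` `[r, +oo[.
  by apply/seteqP; split=> x/=; rewrite in_itv/= andbT.
exact: mphi.
Qed.

Let int_steps (phi : T -> R) m (k : R) : 0 < k -> measurable_wrt (F n) phi ->
  \int[P]_x (steps m (k * phi x) * D x) = 0 /\
  L1 (fun x => steps m (k * phi x) * D x).
Proof.
move=> k0 mphi; elim: m => [|m [IH1 IH2]].
  have E : (fun x => steps 0 (k * phi x) * D x) = cst 0.
    by apply/funext => x; rewrite /steps big_ord0 mul0r.
  rewrite E; split; first by rewrite Rintegral_cst// mul0r.
  exact: finite_measure_integrable_cst.
have FS : F n [set x | m.+1%:R / k <= phi x] by exact: sF_set.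
have E : (fun x => steps m.+1 (k * phi x) * D x) = fun x =>
    steps m (k * phi x) * D x + \1_[set x | m.+1%:R / k <= phi x] x * D x.
  apply/funext => x; rewrite /steps big_ord_recr/= mulrDl; congr (_ + _ * _).
  rewrite indicE; congr (nat_of_bool _)%:R; apply/idP/idP.
    by move=> H; rewrite inE/= ler_pdivrMr// mulrC.
  by rewrite inE/= ler_pdivrMr// mulrC.
have I2 : L1 (fun x => \1_[set x | m.+1%:R / k <= phi x] x * D x).
  apply: (bounded_mul_integrable _ _ 1) => //.
    by apply: measurable_indic; exact: (FF.2.1 n).
  by move=> x; rewrite indicE; case: (_ \in _); rewrite ?normr0 ?normr1.
rewrite E; split; last exact: L1D.
by rewrite RintegralD// IH1 int_indic// addr0.
Qed.

(** The function [k * (phi + M)] is nonnegative and within 1 of a step function whose integral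
    against the increment [D] vanishes. As [D] itself has mean 0, [k * |E (phi D)| <= E |D|] for
    every [k], which forces [E (phi D) = 0]. *)
Lemma martingale_orthogonal (phi : T -> R) (M : R) :
  measurable_wrt (F n) phi -> (forall x, `|phi x| <= M) ->
  \int[P]_x (phi x * (f n.+1 x - f n x)) = 0.
Proof.
move=> mphi bphi.
have wphi : measurable_wrt (F n) (fun x => phi x + M).
  apply/(measurable_wrtP _ _ (FF.1 n)); apply: measurable_funD => //.
  exact/(measurable_wrtP _ _ (FF.1 n)).
have mphi' := filtration_measurable _ _ mphi.
have iphi : L1 (fun x => phi x * D x) by apply: (bounded_mul_integrable _ _ M).
have D0 : \int[P]_x D x = 0.
  have FT : F n setT.
    by have [_ sC _] := FF.1 n; have := sC set0; rewrite setD0; apply; case: (FF.1 n).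
  rewrite -(int_indic _ FT); apply: eq_Rintegral => x _.
  by rewrite indicE in_setT mul1r.
pose I := \int[P]_x `|D x|.
have I0 : 0 <= I by apply: Rintegral_ge0.
have key (k : nat) : (0 < k)%N -> `|\int[P]_x (phi x * D x)| * k%:R <= I.
  move=> k0; have kR0 : 0 < k%:R :> R by rewrite ltr0n.
  (* Since [phi + M <= M + M], this [N] exceeds every value of [k * (phi + M)], so the step function
     is never saturated. *)
  pose N := (Num.trunc (k%:R * (M + M))).+1.
  have [S0 iS] := int_steps (fun x => phi x + M) N k%:R kR0 wphi.
  have psi0 x : 0 <= k%:R * (phi x + M).
    by rewrite mulr_ge0// -lerBlDr sub0r lerNl (le_trans _ (bphi x))// -normrN ler_norm.
  have ap x : `|k%:R * (phi x + M) - steps N (k%:R * (phi x + M))| <= 1.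
    have [_ /(_ _)] := steps_approx N _ (psi0 x).
    have : k%:R * (phi x + M) <= N%:R.
      have M0 : 0 <= M + M.
        by rewrite addr_ge0// (le_trans _ (bphi x)).
      rewrite (@le_trans _ _ (k%:R * (M + M)))//.
        by rewrite ler_wpM2l// lerD2r (le_trans _ (bphi x))// ler_norm.
      by rewrite ltW// Num.Theory.truncnS_gt.
    by move=> H /(_ H) /andP[a b]; rewrite ler_norml; apply/andP; split; lra.
  have iD1 : L1 (fun x => k%:R * M * D x) by exact: L1Z.
  have iD2 : L1 (fun x => k%:R * (phi x * D x)) by exact: L1Z.
  have E : k%:R * \int[P]_x (phi x * D x) =
      \int[P]_x ((k%:R * (phi x + M) - steps N (k%:R * (phi x + M))) * D x).
    transitivity (\int[P]_x (k%:R * (phi x * D x) + k%:R * M * D x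
        - steps N (k%:R * (phi x + M)) * D x)).
      rewrite RintegralB//; last exact: L1D.
      by rewrite RintegralD// S0 RintegralZl// RintegralZl// D0 mulr0 addr0 subr0.
    by apply: eq_Rintegral => x _; ring.
  rewrite -(ger0_norm (ltW kR0)) mulrC -normrM E.
  have iE : L1 (fun x => (k%:R * (phi x + M) - steps N (k%:R * (phi x + M))) * D x).
    have -> : (fun x => (k%:R * (phi x + M) - steps N (k%:R * (phi x + M))) * D x)
       = (fun x => (k%:R * (phi x * D x) + k%:R * M * D x)
        - steps N (k%:R * (phi x + M)) * D x) by apply/funext => x; ring.
    by apply: L1B => //; exact: L1D.
  rewrite (le_trans (le_normr_Rintegral measurableT iE))//.
  apply: le_Rintegral => //.
  - exact: integrable_norm.
  - exact: integrable_norm.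
  - by move=> x _; rewrite normrM -[leRHS]mul1r ler_wpM2r.
apply/normr0_eq0/eqP; rewrite eq_le normr_ge0 andbT leNgt; apply/negP => J0.
have := key (Num.trunc (I / `|\int[P]_x (phi x * D x)|)).+1 isT.
rewrite leNgt => /negP; apply.
by rewrite mulrC -ltr_pdivrMr// Num.Theory.truncnS_gt.
Qed.
End orthogonality.
End martingale_tools.

(** * Integrating a tangent-plane bound *)

Section supermartingale_step.
Context {d : measure_display} {T : measurableType d} {R : realType}.
Variables (P : probability T R) (F : nat -> set (set T)).
Hypothesis FF : filtration F.

Local Notation L1 h := (P.-integrable setT (EFin \o h)).

Lemma measurable_wrt_sigma n (h : T -> R) :
  measurable_wrt (F n) h <-> measurable_fun [set: g_sigma_algebraType (F n)] h.
Proof. exact: measurable_wrtP (FF.1 n). Qed.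

(* The coefficients [a] and [b] need not be bounded: the inequality is first
   integrated over [|a|, |b| <= M]. *)
Lemma supermartingale_step (f g : nat -> T -> R) n (a b Z Z' : T -> R) :
  martingale P F f -> martingale P F g ->
  measurable_wrt (F n) a -> measurable_wrt (F n) b -> L1 Z -> L1 Z' ->
  {ae P, forall x,
    Z' x <= Z x + a x * (f n.+1 x - f n x) + b x * (g n.+1 x - g n x)} ->
  \int[P]_x Z' x <= \int[P]_x Z x.
Proof.
move=> Mf Mg ma mb iZ iZ' H.
pose B M := [set x | `|a x| <= M%:R :> R] `&` [set x | `|b x| <= M%:R :> R].
have FB M : F n (B M).
  have mB : @measurable _ (g_sigma_algebraType (F n)) (B M).
    have S (c : T -> R) : measurable_wrt (F n) c ->
        @measurable _ (g_sigma_algebraType (F n)) [set x | `|c x| <= M%:R].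
      move=> /measurable_wrt_sigma mc.
      rewrite (_ : [set _ | _] = c @^-1` `[- M%:R, M%:R]); last first.
        by apply/seteqP; split=> x/=; rewrite in_itv/= ler_norml.
      by rewrite -[_ @^-1` _]setTI; exact: mc.
    by apply: measurableI; exact: S.
  by move: mB; rewrite -[X in _ -> X _](sigma_algebra_id (FF.1 n)).
have trunc (c : T -> R) (h : nat -> T -> R) M : martingale P F h -> measurable_wrt (F n) c ->
    (forall x, B M x -> `|c x| <= M%:R) ->
    \int[P]_x ((\1_(B M) x * c x) * (h n.+1 x - h n x)) = 0 /\
    L1 (fun x => (\1_(B M) x * c x) * (h n.+1 x - h n x)).
  move=> Mh mc cM.
  have wc : measurable_wrt (F n) (fun x => \1_(B M) x * c x).
    apply/measurable_wrt_sigma; apply: measurable_funM; last exact/measurable_wrt_sigma.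
    apply: measurable_indic; have := FB M.
    by rewrite -[X in X _ -> _](sigma_algebra_id (FF.1 n)).
  have bc x : `|\1_(B M) x * c x| <= M%:R.
    rewrite indicE; case: (boolP (x \in B M)); last by rewrite mul0r normr0.
    by rewrite inE mul1r => /cM.
  split; first exact: (martingale_orthogonal P F h n FF Mh _ _ wc bc).
  apply: (bounded_mul_integrable P _ _ _ _ bc); first exact: (filtration_measurable F FF _ _ wc).
  by apply: L1B; exact: Mh.2.1.
have iW : L1 (fun x => Z x - Z' x) by exact: L1B.
have mB M : measurable (B M) by exact: (FF.2.1 n).
have iBW M : L1 (fun x => \1_(B M) x * (Z x - Z' x)).
  apply: (bounded_mul_integrable _ _ _ 1) => //.
  by move=> x; rewrite indicE; case: (_ \in _); rewrite ?normr0 ?normr1.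
have int_ge0 M : 0 <= \int[P]_x (\1_(B M) x * (Z x - Z' x)).
  have [a0 ia] := trunc a f M Mf ma (fun x => @proj1 _ _).
  have [b0 ib] := trunc b g M Mg mb (fun x => @proj2 _ _).
  have : 0 <= \int[P]_x (\1_(B M) x * (Z x - Z' x) +
      ((\1_(B M) x * a x) * (f n.+1 x - f n x) + (\1_(B M) x * b x) * (g n.+1 x - g n x))).
    apply: ae_Rintegral_ge0; first by apply: L1D => //; exact: L1D.
    apply: filterS H => x Hx.
    by rewrite -!mulrA -!mulrDr mulr_ge0// ?indicE//; lra.
  by rewrite RintegralD//; [rewrite RintegralD// a0 b0 !addr0|exact: L1D].
rewrite -subr_ge0 -RintegralB//.
(* The sets [B M] exhaust the space, so the truncation is removed by dominated convergence with
   majorant [|Z - Z'|]. *)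
have cv : (\int[P]_x (\1_(B M) x * (Z x - Z' x))%:E)%E @[M --> \oo] -->
    (\int[P]_x (Z x - Z' x)%:E)%E.
  apply: (@dominated_cvg _ _ _ P setT measurableT
     (fun M x => (\1_(B M) x * (Z x - Z' x))%:E) (fun x => (Z x - Z' x)%:E)
     (fun x => `|(Z x - Z' x)%:E|)%E).
  - by move=> M; exact: measurable_int (iBW M).
  - move=> x _; apply: cvg_near_cst.
    exists (Num.trunc (Num.max `|a x| `|b x|)).+1 => // M/= HM.
    rewrite indicE mem_set ?mul1r//.
    have : Num.max `|a x| `|b x| <= M%:R.
      by rewrite (le_trans (ltW (truncnS_gt _)))// ler_nat.
    by rewrite ge_max => /andP.
  - by [].
  - exact: integrable_abse iW.
  - move=> M x _; rewrite !abse_EFin lee_fin normrM -[leRHS]mul1r ler_wpM2r//.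
    by rewrite indicE; case: (_ \in _); rewrite ?normr0 ?normr1.
rewrite /Rintegral fine_ge0// -(cvg_lim _ cv)//.
apply: lime_ge; first by apply/cvg_ex; eexists; exact: cv.
apply: nearW => M.
by rewrite -(fineK (integrable_fin_num measurableT (iBW M))) lee_fin; exact: int_ge0.
Qed.

End supermartingale_step.

(** * Stopping when the maximal function reaches the level *)

(** Finite-horizon counterpart of [maxfun]; it is adapted, so it can decide when the level has been
    reached. *)
Fixpoint runmax {T : Type} {R : realType} (g : nat -> T -> R) (n : nat) (x : T) : R :=
  if n is m.+1 then Num.max (runmax g m x) `|g n x| else `|g 0%N x|.

Lemma le_runmax {T : Type} {R : realType} (g : nat -> T -> R) n x :
  `|g n x| <= runmax g n x.
Proof. by case: n => [|n] /=; rewrite ?le_max lexx ?orbT. Qed.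

Lemma runmax_nondecreasing {T : Type} {R : realType} (g : nat -> T -> R) m n x :
  (m <= n)%N -> runmax g m x <= runmax g n x.
Proof.
move=> /subnK <-; elim: (n - m)%N => [|k IH]; first by rewrite add0n.
by rewrite addSn /= le_max IH.
Qed.

Section stopped_supermartingale.
Context {d : measure_display} {T : measurableType d} {R : realType}.
Variables (P : probability T R) (F : nat -> set (set T)) (f g : nat -> T -> R).
Hypotheses (FF : filtration F) (Mf : martingale P F f) (Mg : martingale P F g).
Hypothesis f_ge0 : forall n, {ae P, forall x, 0 <= f n x}.
Hypothesis dg_le : forall n, {ae P, forall x, `|diffseq g n x| <= `|diffseq f n x|}.

Local Notation L1 h := (P.-integrable setT (EFin \o h)).

Lemma runmax_adapted n : measurable_wrt (F n) (runmax g n).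
Proof.
elim: n => [|n IH]; apply/(measurable_wrt_sigma F FF).
  by apply: measurableT_comp => //; apply/(measurable_wrt_sigma F FF); exact: Mg.1.
apply: measurable_maxr.
  by apply/(measurable_wrt_sigma F FF) => B mB; apply: FF.2.2; exact: IH.
by apply: measurableT_comp => //; apply/(measurable_wrt_sigma F FF); exact: Mg.1.
Qed.

(** A scheme for both ranges of exponents. [Phi] is evaluated before the level [l] is reached, with
    slopes [Phix] and [Phiy]; the function [xi] of [f] alone takes over afterwards, with slope
    [xi']. [q] is a common majorant for integrability. *)
Variables (Phi Phix Phiy : R -> R -> R) (xi xi' q : R -> R) (l : R).
Hypothesis l0 : 0 < l.
Hypothesis Phi_step : forall x y h k, 0 <= x -> `|y| < 1 -> 0 <= x + h ->
  `|k| <= `|h| -> Phi (x + h) (y + k) <= Phi x y + Phix x y * h + Phiy x y * k.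
Hypothesis xi_Phi : forall x y, 0 <= x -> 1 <= `|y| -> xi x <= Phi x y.
Hypothesis xi_step : forall x h, 0 <= x -> 0 <= x + h ->
  xi (x + h) <= xi x + xi' x * h.
Hypothesis mPhi : measurable_fun [set: R * R] (fun z => Phi z.1 z.2).
Hypothesis mPhix : measurable_fun [set: R * R] (fun z => Phix z.1 z.2).
Hypothesis mPhiy : measurable_fun [set: R * R] (fun z => Phiy z.1 z.2).
Hypothesis mxi : measurable_fun [set: R] xi.
Hypothesis mxi' : measurable_fun [set: R] xi'.
Hypothesis Phi_bound : forall x y, 0 <= x -> `|y| < 1 -> `|Phi x y| <= q x.
Hypothesis xi_bound : forall x, 0 <= x -> `|xi x| <= q x.
Hypothesis iq : forall n, L1 (fun x => q (`|f n x| / l)).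

(** After the crossing [f] keeps running and [g] is forgotten, so the final estimate involves [f n]
    itself. Absolute values of [f] are used because [f] is nonnegative only almost everywhere, while
    the bounds are wanted at every point. *)
Definition stopped n (A : R -> R -> R) (b : R -> R) x : R :=
  if runmax g n x < l then A (`|f n x| / l) (g n x / l) else b (`|f n x| / l).

Let f_meas n : measurable_fun [set: g_sigma_algebraType (F n)] (fun x => `|f n x| / l).
Proof.
apply: measurable_funM => //; apply: measurableT_comp => //.
by apply/(measurable_wrt_sigma F FF); exact: Mf.1.
Qed.

Let g_meas n : measurable_fun [set: g_sigma_algebraType (F n)] (fun x => g n x / l).
Proof.
by apply: measurable_funM => //; apply/(measurable_wrt_sigma F FF); exact: Mg.1.
Qed.

Lemma stopped_adapted n A b : measurable_fun [set: R * R] (fun z => A z.1 z.2) ->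
  measurable_fun [set: R] b -> measurable_wrt (F n) (stopped n A b).
Proof.
move=> mA mb; apply/(measurable_wrt_sigma F FF).
apply: measurable_fun_ifT.
- by apply: measurable_fun_ltr => //; apply/(measurable_wrt_sigma F FF); exact: runmax_adapted.
- exact: (measurableT_comp mA (measurable_fun_pair (f_meas n) (g_meas n))).
- exact: (measurableT_comp mb (f_meas n)).
Qed.

Let fl_ge0 n x : 0 <= `|f n x| / l.
Proof. by rewrite divr_ge0// ltW. Qed.

Let gl_lt1 n x : runmax g n x < l -> `|g n x / l| < 1.
Proof.
move=> H; rewrite normrM (gtr0_norm (_ : 0 < l^-1)) ?invr_gt0//.
by rewrite ltr_pdivrMr// mul1r (le_lt_trans (le_runmax g n x)).
Qed.

Lemma stopped_integrable n : L1 (stopped n Phi xi).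
Proof.
apply: (le_integrable measurableT _ _ (iq n)).
  apply/measurable_EFinP.
  by apply: (filtration_measurable F FF _ n); exact: stopped_adapted.
move=> x _ /=; rewrite lee_fin (le_trans _ (ler_norm _))// /stopped.
by case: ifPn => H; [apply: Phi_bound => //; exact: gl_lt1|exact: xi_bound].
Qed.

(** Before the crossing the tangent bound of [Phi] applies, and after it that of [xi]. At the
    crossing time the new value [xi] is first bounded by [Phi] at the new point, where [|g| >= l].
    The slopes are divided by [l] because the increments are not rescaled. *)
Lemma stopped_nonincreasing n :
  \int[P]_x stopped n.+1 Phi xi x <= \int[P]_x stopped n Phi xi x.
Proof.
pose al x := stopped n Phix xi' x / l.
pose be x := stopped n Phiy (fun=> 0) x / l.
have ma : measurable_wrt (F n) al.
  apply/(measurable_wrt_sigma F FF); apply: measurable_funM => //.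
  by apply/(measurable_wrt_sigma F FF); exact: stopped_adapted.
have mb : measurable_wrt (F n) be.
  apply/(measurable_wrt_sigma F FF); apply: measurable_funM => //.
  by apply/(measurable_wrt_sigma F FF); exact: stopped_adapted.
apply: (supermartingale_step P F FF f g n al be) => //; [exact: stopped_integrable..|].
apply: filterS3 (f_ge0 n) (f_ge0 n.+1) (dg_le n.+1) => x f0 f1 /= dg.
have lV0 : 0 < l^-1 by rewrite invr_gt0.
rewrite /al /be /stopped !(ger0_norm f0) !(ger0_norm f1).
set u := f n x / l; set v := g n x / l.
set h := (f n.+1 x - f n x) / l; set k := (g n.+1 x - g n x) / l.
have u0 : 0 <= u by rewrite divr_ge0// ltW.
have uh : f n.+1 x / l = u + h by rewrite /u /h; ring.
have vk : g n.+1 x / l = v + k by rewrite /v /k; ring.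
have uh0 : 0 <= u + h by rewrite -uh divr_ge0// ltW.
have kh : `|k| <= `|h| by rewrite /k /h !normrM ler_wpM2r.
rewrite uh vk -![_ / l * (_ - _)]mulrA -![l^-1 * (_ - _)]mulrC -/h -/k.
have [r1|r1] := ltP (runmax g n x) l; last first.
  rewrite ifF; last by apply/negbTE; rewrite -leNgt (le_trans r1)// (runmax_nondecreasing g n n.+1 x).
  by rewrite mul0r addr0; exact: xi_step.
have v1 := gl_lt1 _ _ r1.
apply: le_trans (Phi_step _ _ _ _ u0 v1 uh0 kh).
case: ifPn => //= ; rewrite gt_max r1/= -leNgt => gl.
apply: xi_Phi => //; rewrite -vk normrM (gtr0_norm lV0).
by rewrite ler_pdivlMr// mul1r.
Qed.

Lemma stopped_le0 n : \int[P]_x stopped n Phi xi x <= \int[P]_x stopped 0 Phi xi x.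
Proof.
by elim: n => [//|n IH]; exact: le_trans (stopped_nonincreasing n) IH.
Qed.

End stopped_supermartingale.

(** * From running maxima to the weak norm *)

Section weak_norm.
Context {d : measure_display} {T : measurableType d} {R : realType}.
Variables (P : probability T R) (p : R) (g : nat -> T -> R).
Hypothesis p0 : 0 < p.
Hypothesis mg : forall n, measurable_fun setT (g n).

Lemma measurable_runmax n : measurable_fun setT (runmax g n).
Proof.
elim: n => [|n IH]; first exact: measurableT_comp.
by apply: measurable_maxr => //; exact: measurableT_comp.
Qed.

Lemma maxfun_lt_runmax (l : R) x : (l%:E < maxfun g x)%E -> exists n, l < runmax g n x.
Proof.
move=> /ereal_sup_gt[_ [n _ <-]]; rewrite lte_fin => H.
by exists n; rewrite (lt_le_trans H)// le_runmax.
Qed.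

(** The supremum may equal [l] without being attained, hence an intersection over levels increasing
    to [l]. *)
Lemma measurable_maxfun_ge (l : R) : measurable [set x | (l%:E <= maxfun g x)%E].
Proof.
have -> : [set x | (l%:E <= maxfun g x)%E] =
    \bigcap_m \bigcup_n [set x | l - m.+1%:R^-1 < `|g n x|].
  apply/seteqP; split=> x /=.
    move=> H m _; have : ((l - m.+1%:R^-1)%:E < maxfun g x)%E.
      by rewrite (lt_le_trans _ H)// lte_fin ltrBlDr ltrDl invr_gt0.
    by move=> /ereal_sup_gt[_ [n _ <-]]; rewrite lte_fin => ?; exists n.
  move=> H; apply/lee_addgt0Pr => e e0.
  have [m _ me] := near_infty_natSinv_lt (PosNum e0).
  have [n _ /= Hn] := H m I.
  rewrite (@le_trans _ _ (`|g n x| + e)%:E)//.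
    rewrite lee_fin -lerBlDr ltW// (le_lt_trans _ Hn)// lerB// ltW//.
    by have /= := me m (leqnn m).
  by rewrite EFinD leeD2r//; apply: ereal_sup_ubound; exists n.
apply: bigcap_measurable => // m _; apply: bigcup_measurable => n _.
rewrite (_ : [set _ | _] = (fun x => `|g n x|) @^-1` `]l - m.+1%:R^-1, +oo[); last first.
  by apply/seteqP; split=> x /=; rewrite in_itv/= andbT.
by rewrite -[_ @^-1` _]setTI; apply: measurableT_comp.
Qed.

(** For [l' < l], the event that [maxfun] is at least [l] lies in the increasing union over [n] of
    the events that [runmax] is at least [l']. Continuity from below transfers the bound to the
    level [l'], and [l'] may be taken arbitrarily close to [l]. *)
Lemma mweaknorm_le (N : \bar R) : (0 <= N)%E ->
  (forall (l : R) n, 0 < l ->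
    (l%:E * (P [set x | (l <= runmax g n x)%R]) `^ p^-1 <= N)%E) ->
  (mweaknorm P p g <= N)%E.
Proof.
move=> N0 H; apply: ub_ereal_sup => _ [l /= l0 <-].
have mrun l' n : measurable [set x | l' <= runmax g n x].
  rewrite (_ : [set _ | _] = runmax g n @^-1` `[l', +oo[); last first.
    by apply/seteqP; split=> x /=; rewrite in_itv/= andbT.
  by rewrite -[_ @^-1` _]setTI; apply: measurable_runmax.
case: N N0 H => [r| |] //; last by move=> _ _; rewrite leey.
rewrite lee_fin => r0 H.
have Pfin A : measurable A -> exists2 a : R, P A = a%:E & 0 <= a.
  move=> mA; exists (fine (P A)); last exact: fine_ge0.
  by rewrite fineK// fin_num_measure.
have [a Pa a0] := Pfin _ (measurable_maxfun_ge l).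
have step l' : 0 < l' < l -> l' * a `^ p^-1 <= r.
  move=> /andP[l'0 l'l].
  have bound n : (P [set x | (l' <= runmax g n x)%R] <= ((r / l') `^ p)%:E)%E.
    have [b Pb b0] := Pfin _ (mrun l' n).
    have := H l' n l'0; rewrite Pb poweR_EFin -EFinM !lee_fin => Hb.
    rewrite -[leLHS]powRr1// -(@mulVf _ p) ?gt_eqF// powRrM.
    have Hb' : b `^ p^-1 <= r / l' by rewrite ler_pdivlMr// mulrC.
    apply: ge0_ler_powR (Hb') => //; rewrite ?nnegrE ?powR_ge0//; first exact: ltW.
    by rewrite divr_ge0// ltW.
  have mU : measurable (\bigcup_n [set x | l' <= runmax g n x]) by exact: bigcup_measurable.
  have PU : (P (\bigcup_n [set x | (l' <= runmax g n x)%R]) <= ((r / l') `^ p)%:E)%E.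
    have cv : (P \o (fun n => [set x | (l' <= runmax g n x)%R])) n @[n --> \oo] -->
        P (\bigcup_n [set x | (l' <= runmax g n x)%R]).
      apply: nondecreasing_cvg_mu => // m n mn; apply/subsetPset => x /= /le_trans; apply.
      exact: runmax_nondecreasing.
    rewrite -(cvg_lim _ cv)//; apply: lime_le; last exact: nearW.
    by apply/cvg_ex; eexists; exact: cv.
  have aU : a <= (r / l') `^ p.
    rewrite -lee_fin -Pa (le_trans _ PU)// le_measure ?inE//; first exact: measurable_maxfun_ge.
    move=> x /= Hx; have /maxfun_lt_runmax[n Hn] : (l'%:E < maxfun g x)%E.
      by rewrite (lt_le_trans _ Hx)// lte_fin.
    by exists n => //=; exact: ltW.
  have : a `^ p^-1 <= r / l'.
    have rl0 : 0 <= r / l' by rewrite divr_ge0// ltW.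
    rewrite -[leRHS]powRr1// -(@mulfV _ p) ?gt_eqF// powRrM.
    by apply: ge0_ler_powR (aU) => //; rewrite ?nnegrE ?powR_ge0// invr_ge0 ltW.
  by rewrite ler_pdivlMr// mulrC.
rewrite Pa poweR_EFin -EFinM lee_fin leNgt; apply/negP => Hr.
have b0 : 0 < a `^ p^-1.
  rewrite lt_neqAle powR_ge0 andbT eq_sym; apply/eqP => b0.
  by move: Hr; rewrite b0 mulr0 ltNge r0.
have rl : r / a `^ p^-1 < l by rewrite ltr_pdivrMr.
have m0 : 0 <= r / a `^ p^-1 by rewrite divr_ge0// ltW.
(* If the bound failed at [l], it would already fail at this midpoint, which is below [l]. *)
pose m := (r / a `^ p^-1 + l) / 2.
have := step m; rewrite /m => /(_ _).
have -> : 0 < (r / a `^ p^-1 + l) / 2 < l by apply/andP; split; lra.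
move=> /(_ isT); rewrite -ler_pdivlMr//; lra.
Qed.
End weak_norm.

(** * The weak-type bounds *)

Section weak_type_bounds.
Context {d : measure_display} {T : measurableType d} {R : realType}.
Variables (P : probability T R) (F : nat -> set (set T)) (f g : nat -> T -> R).
Hypotheses (FF : filtration F) (Mf : martingale P F f) (Mg : martingale P F g).
Hypothesis f_ge0 : forall n, {ae P, forall x, 0 <= f n x}.
Hypothesis dg_le : forall n, {ae P, forall x, `|diffseq g n x| <= `|diffseq f n x|}.

Local Notation L1 h := (P.-integrable setT (EFin \o h)).

Let mf n : measurable_fun setT (f n).
Proof. by apply: (filtration_measurable F FF _ n); exact: Mf.1. Qed.

Let mg n : measurable_fun setT (g n).
Proof. by apply: (filtration_measurable F FF _ n); exact: Mg.1. Qed.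

Let mfp n p : measurable_fun setT (fun x => `|f n x| `^ p).
Proof. by apply: (measurableT_comp (measurable_powR p)); exact: measurableT_comp. Qed.

Let mA (l : R) n : measurable [set x | l <= runmax g n x].
Proof.
rewrite (_ : [set _ | _] = runmax g n @^-1` `[l, +oo[); last first.
  by apply/seteqP; split=> x /=; rewrite in_itv/= andbT.
by rewrite -[_ @^-1` _]setTI; apply: measurable_runmax.
Qed.

Let Rint_indic A : measurable A -> \int[P]_x \1_A x = fine (P A) :> R.
Proof. by move=> mA'; rewrite /Rintegral integral_indic// setIT. Qed.

Let L1_indic A : measurable A -> L1 (\1_A : T -> R).
Proof.
by move=> mA'; apply: integrable_indic => //; rewrite -ge0_fin_numE ?fin_num_measure.
Qed.

Lemma mnorm_ge (p : R) n :
  ((\int[P]_x (`|f n x| `^ p)%:E) `^ p^-1 <= mnorm P p f)%E.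
Proof. by apply: ereal_sup_ubound; exists n. Qed.

(** Takes [p]-th roots in a tail estimate. The time [k] of the moment is free: it is [n] for large
    exponents and [0] for small ones. *)
Lemma weak_type_mnorm (p C l : R) k (A : set T) : 0 < p -> 0 < C -> 0 < l ->
  measurable A -> L1 (fun x => `|f k x| `^ p) ->
  fine (P A) <= C `^ p * \int[P]_x (`|f k x| / l) `^ p ->
  (l%:E * (P A) `^ p^-1 <= C%:E * mnorm P p f)%E.
Proof.
move=> p0 C0 l0 mA' ifp H.
apply: (@le_trans _ _ (C%:E * (\int[P]_x (`|f k x| `^ p)%:E) `^ p^-1)%E); last first.
  by rewrite lee_pmul2l//; exact: mnorm_ge.
have E : \int[P]_x (`|f k x| / l) `^ p = l^-1 `^ p * \int[P]_x `|f k x| `^ p.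
  rewrite -RintegralZl//; apply: eq_Rintegral => x _.
  by rewrite mulrC powRM// invr_ge0 ltW.
rewrite {}E in H.
have -> : (\int[P]_x (`|f k x| `^ p)%:E)%E = (\int[P]_x `|f k x| `^ p)%:E.
  by rewrite /Rintegral fineK//; exact: integrable_fin_num ifp.
rewrite -(fineK (fin_num_measure P _ mA')) !poweR_EFin -!EFinM lee_fin.
set I := \int[P]_x `|f k x| `^ p in H *; set b := fine _ in H *.
have I0 : 0 <= I by apply: Rintegral_ge0 => x _; exact: powR_ge0.
have b0 : 0 <= b by exact: fine_ge0.
rewrite -ler_pdivlMl// mulrC.
have -> : C * I `^ p^-1 / l = (C `^ p * (l^-1 `^ p * I)) `^ p^-1.
  rewrite !powRM ?mulr_ge0 ?powR_ge0// -!powRrM mulfV ?gt_eqF//.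
  by rewrite !powRr1 ?invr_ge0 ?ltW//; ring.
by apply: ge0_ler_powR (H) => //; rewrite ?nnegrE ?mulr_ge0 ?powR_ge0// invr_ge0 ltW.
Qed.

Lemma measurable_sgr : measurable_fun [set: R] (@Num.sg R).
Proof.
rewrite (_ : @Num.sg R = fun y => (if 0 < y then 1 else 0) - (if y < 0 then 1 else 0)).
  by apply: measurable_funB; apply: measurable_fun_ifT => //; exact: measurable_fun_ltr.
apply/funext => y; have [y0|y0|<-] := ltgtP 0 y.
- by rewrite gtr0_sg// subr0.
- by rewrite ltr0_sg// sub0r.
- by rewrite sgr0 subr0.
Qed.

(** * The bound for [2 <= p] *)

Section large_exponent.
Variable p : R.
Hypothesis p2 : 2 <= p.

Let mtau : measurable_fun [set: R * R] (fun z => tau p z.1 `|z.2|).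
Proof.
apply: measurable_minr => //; apply: measurable_maxr.
  by apply: measurable_funD => //; exact: measurableT_comp.
apply: measurable_funM => //; apply: measurable_funB => //.
exact: measurableT_comp.
Qed.

Let mtau_powR r : measurable_fun [set: R * R] (fun z => tau p z.1 `|z.2| `^ r).
Proof. exact: (measurableT_comp (measurable_powR r)). Qed.

Lemma measurable_usp : measurable_fun [set: R * R] (fun z => usp p z.1 z.2).
Proof.
have m2 : measurable_fun [set: R * R] (fun z => `|z.2|) by exact: measurableT_comp.
rewrite /usp /psi; apply: measurable_funM => //; apply: measurable_funD.
  apply: measurable_funB; apply: measurable_funM => //.
  - by apply: measurable_funB; exact: measurable_funX.
  - exact: measurable_funM.
  - by apply: measurable_funB => //; exact: measurable_funM.
exact: measurable_funM.
Qed.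

Lemma measurable_usp_x : measurable_fun [set: R * R] (fun z => usp_x p z.1 z.2).
Proof.
apply: measurable_funM => //; apply: measurable_funB.
  by apply: measurable_funM => //; exact: measurable_funM.
by apply: measurable_funM => //; exact: measurable_funM.
Qed.

Lemma measurable_usp_y : measurable_fun [set: R * R] (fun z => usp_y p z.1 z.2).
Proof.
apply: measurable_funM => //; apply: measurable_funB.
  by apply: measurable_funM => //; exact: measurable_funM.
apply: measurable_funM => //; first exact: measurable_funM.
exact: (measurableT_comp measurable_sgr).
Qed.

Let kspec_ge0 : 0 <= kspec p.
Proof. by have := p2 => p2'; rewrite divr_ge0 ?powR_ge0//; lra. Qed.

(** Bernoulli's inequality at [(x + h) / x], scaled by [x ^ p]. *)
Lemma powR_tangent (x h : R) : 0 <= x -> 0 <= x + h ->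
  x `^ p + p * x `^ (p - 1) * h <= (x + h) `^ p.
Proof.
have p1 : 1 <= p by have := p2; lra.
have p0 : 0 < p by have := p2; lra.
move=> x0 xh; have [xE|xn0] := eqVneq x 0.
  by rewrite xE !powR0 ?mulr0 ?mul0r ?addr0 ?powR_ge0// gt_eqF//; have := p2; lra.
have xp : 0 < x by rewrite lt_neqAle eq_sym xn0.
have w0 : 0 <= (x + h) / x by rewrite divr_ge0.
have B := bernoulli_powR p _ p1 w0.
have -> : (x + h) `^ p = x `^ p * ((x + h) / x) `^ p.
  by rewrite -powRM// mulrC divfK.
apply: le_trans (ler_wpM2l (powR_ge0 x p) B).
rewrite -(mulr_powRB1 x0 p0) le_eqVlt; apply/orP; left; apply/eqP.
by field.
Qed.

Lemma weak_type_large (l : R) n : 0 < l ->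
  (forall k, L1 (fun x => `|f k x| `^ p)) ->
  fine (P [set x | l <= runmax g n x]) <= kspec p * \int[P]_x (`|f n x| / l) `^ p.
Proof.
move=> l0 ifp.
have p2' := p2; have p0 : 0 < p by lra.
pose xi (x : R) := 1 - kspec p * x `^ p.
pose xi' (x : R) := - (kspec p * (p * x `^ (p - 1))).
pose q (x : R) := (p ^+ 2 + kspec p + 1) * (1 + x `^ p).
have ifl k : L1 (fun x => (`|f k x| / l) `^ p).
  rewrite (_ : (fun x => _) = fun x => l^-1 `^ p * `|f k x| `^ p); first exact: L1Z.
  by apply/funext => x; rewrite mulrC powRM// invr_ge0 ltW.
have iq k : L1 (fun x => q (`|f k x| / l)).
  by apply: L1Z; apply: L1D => //; exact: finite_measure_integrable_cst.
have mxi : measurable_fun [set: R] xi.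
  by apply: measurable_funB => //; apply: measurable_funM => //; exact: measurable_powR.
have mxi' : measurable_fun [set: R] xi'.
  rewrite (_ : xi' = fun x => - (kspec p * p) * x `^ (p - 1)).
    by apply: measurable_funM => //; exact: measurable_powR.
  by apply/funext => x; rewrite /xi'; ring.
have Phi_bound x y : 0 <= x -> `|y| < 1 -> `|usp p x y| <= q x.
  move=> x0 y1; have H1 := usp_ge p p2 x y x0; have H2 := usp_le p p2 x y x0 (ltW y1).
  have X0 := powR_ge0 x p; have k0 := kspec_ge0.
  have pp : 0 <= p ^+ 2 by exact: sqr_ge0.
  have A1 : 0 <= p ^+ 2 * x `^ p by exact: mulr_ge0.
  have A2 : 0 <= kspec p * x `^ p by exact: mulr_ge0.
  by rewrite ler_norml /q; apply/andP; split; lra.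
have xi_bound x : 0 <= x -> `|xi x| <= q x.
  move=> x0; have X0 := powR_ge0 x p; have k0 := kspec_ge0.
  have pp : 0 <= p ^+ 2 by exact: sqr_ge0.
  have A1 : 0 <= p ^+ 2 * x `^ p by exact: mulr_ge0.
  have A2 : 0 <= kspec p * x `^ p by exact: mulr_ge0.
  by rewrite ler_norml /q /xi; apply/andP; split; lra.
have xi_step x h : 0 <= x -> 0 <= x + h -> xi (x + h) <= xi x + xi' x * h.
  move=> x0 xh; have := ler_wpM2l kspec_ge0 (powR_tangent x h x0 xh).
  by rewrite /xi /xi'; lra.
have step x y h k : 0 <= x -> `|y| < 1 -> 0 <= x + h -> `|k| <= `|h| ->
    usp p (x + h) (y + k) <= usp p x y + usp_x p x y * h + usp_y p x y * k.
  by move=> x0 _; exact: usp_step.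
have xiP x y : 0 <= x -> 1 <= `|y| -> xi x <= usp p x y by exact: usp_ge1.
have main := stopped_le0 P F f g FF Mf Mg f_ge0 dg_le (usp p) (usp_x p) (usp_y p)
  xi xi' q l l0 step xiP xi_step measurable_usp measurable_usp_x measurable_usp_y
  mxi mxi' Phi_bound xi_bound iq n.
have iZ := stopped_integrable P F f g FF Mf Mg (usp p) xi q l l0
  measurable_usp mxi Phi_bound xi_bound iq.
(* Initially [|g 0| <= f 0], so [usp] is nonpositive; if the level is reached at once, [xi <= usp]
   gives the same sign. *)
have Z0 : \int[P]_x stopped f g l 0 (usp p) xi x <= 0.
  have -> : 0 = \int[P]_x (0 : R) by rewrite Rintegral_cst// mul0r.
  apply: ae_le_Rintegral => //; first exact: finite_measure_integrable_cst.
  apply: filterS2 (f_ge0 0) (dg_le 0) => x f0 /= dg0.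
  have I : usp p (`|f 0 x| / l) (g 0 x / l) <= 0.
    by apply: usp_init => //; rewrite normrM (gtr0_norm (_ : 0 < l^-1)) ?invr_gt0// ler_wpM2r// invr_ge0 ltW.
  rewrite /stopped /=; case: ifPn => // gl.
  apply: le_trans I; apply: xiP; first by rewrite divr_ge0// ltW.
  by rewrite normrM (gtr0_norm (_ : 0 < l^-1)) ?invr_gt0// ler_pdivlMr// mul1r leNgt.
have iZn : L1 (fun x => \1_[set x | l <= runmax g n x] x - kspec p * (`|f n x| / l) `^ p).
  by apply: L1B; [exact: L1_indic|exact: L1Z].
rewrite -subr_le0 -(Rint_indic _ (mA l n)) -RintegralZl// -RintegralB//; last 2 first.
- exact: L1_indic.
- exact: L1Z.
apply: le_trans (le_trans main Z0).
(* Domination at time [n]: after the crossing there is equality with [xi], before it [usp_ge] is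
   used. *)
apply: le_Rintegral => // x _; rewrite /stopped indicE.
have fl0 : 0 <= `|f n x| / l by rewrite divr_ge0// ltW.
have [r1|r1] := ltP (runmax g n x) l.
  rewrite memNset ?sub0r; first exact: usp_ge.
  by move=> /=; rewrite leNgt r1.
by rewrite mem_set.
Qed.

Lemma mweaknorm_large :
  (mweaknorm P p g <= (p / 2 * (p - 1) `^ (- p^-1))%:E * mnorm P p f)%E.
Proof.
have p2' := p2; have p0 : 0 < p by lra.
have C0 : 0 < p / 2 * (p - 1) `^ (- p^-1).
  by rewrite mulr_gt0 ?divr_gt0 ?powR_gt0//; lra.
have N0 : (0 <= mnorm P p f)%E by apply: le_trans (mnorm_ge p 0); exact: poweR_ge0.
apply: mweaknorm_le => //; first by rewrite mule_ge0// lee_fin ltW.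
move=> l n l0.
have [->|Nfin] := eqVneq (mnorm P p f) +oo%E; first by rewrite gt0_muley ?lte_fin// leey.
have ifp k : L1 (fun x => `|f k x| `^ p).
  apply/integrableP; split; first exact/measurable_EFinP.
  rewrite ltey; apply/negP => /eqP E.
  move/negP: Nfin; apply; rewrite eq_le leey/=.
  have Iy : (\int[P]_x (`|f k x| `^ p)%:E)%E = +oo%E.
    by rewrite -[RHS]E; apply: eq_integral => x _ /=; rewrite norm_powR// normr_id.
  have := mnorm_ge p k; rewrite Iy poweRyr// gt_eqF//= invr_gt0//.
apply: (weak_type_mnorm p _ l n) => //.
suff -> : (p / 2 * (p - 1) `^ (- p^-1)) `^ p = kspec p by exact: weak_type_large.
rewrite powRM ?powR_ge0 ?divr_ge0//; [|lra].
rewrite -powRrM mulNr mulVf ?gt_eqF// powR_inv1 ?/kspec//; lra.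
Qed.
End large_exponent.

(** * The bound for [0 < p < 1] *)

Section small_exponent.

(** On the triangle the formula is [1 - ((1 - x)^2 - y^2)], which matches the cap 1 along the edge
    [x + |y| = 1]. *)
Definition wsp (x y : R) : R := if x + `|y| < 1 then 2 * x + y ^+ 2 - x ^+ 2 else 1.

Let wsp_le1 x y : 0 <= x -> wsp x y <= 1.
Proof.
rewrite /wsp; case: ifPn => // s x0; have := normr_ge0 y => y0.
rewrite -(real_normK (num_real y)); nra.
Qed.

Let wsp_ge0 x y : 0 <= x -> 0 <= wsp x y.
Proof.
rewrite /wsp; case: ifPn => // s x0; have := normr_ge0 y => y0.
have := sqr_ge0 y; nra.
Qed.

(** From inside the triangle the right-hand side equals [1 - (1 - x - h)^2 + (y + k)^2 + h^2 - k^2].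
    If the jump stays inside, only [k^2 <= h^2] is needed; if it leaves, this expression must be at
    least 1. *)
Lemma wsp_step x y h k : 0 <= x -> 0 <= x + h -> `|k| <= `|h| ->
  wsp (x + h) (y + k) <= wsp x y
    + (if x + `|y| < 1 then 2 - 2 * x else 0) * h
    + (if x + `|y| < 1 then 2 * y else 0) * k.
Proof.
move=> x0 xh kh; rewrite {2}/wsp.
case: ifPn => s; last by rewrite !mul0r !addr0; exact: wsp_le1.
have kh2 : k ^+ 2 <= h ^+ 2.
  by rewrite -(real_normK (num_real k)) -(real_normK (num_real h)) ler_pXn2r ?nnegrE.
rewrite /wsp; case: ifPn => S; first by nra.
rewrite -leNgt in S.
have y0 := normr_ge0 y; have Y0 := normr_ge0 (y + k).
pose Y := `|y + k|.
suff : (1 - (x + h)) ^+ 2 - Y ^+ 2 <= h ^+ 2 - k ^+ 2.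
  by rewrite /Y real_normK ?num_real//; nra.
have [S1|S1] := leP `|1 - (x + h)| Y.
  have : `|1 - (x + h)| ^+ 2 <= Y ^+ 2 by rewrite ler_pXn2r ?nnegrE.
  by rewrite real_normK ?num_real//; lra.
(* The jump passes [x = 1], so [h > 1 - x > |y|]. With [- y k <= |y| h], the claim becomes
   [(1 - x - |y|) (1 - x + |y| - 2 h) <= 0]. *)
have X1 : 1 < x + h.
  rewrite ltNge; apply/negP => X1.
  by move: S1; rewrite ger0_norm ?subr_ge0// /Y; lra.
have h0 : 0 < h by lra.
rewrite (gtr0_norm h0) in kh.
have yk : - (`|y| * h) <= y * k.
  by rewrite lerNl (le_trans (ler_norm _))// normrN normrM ler_wpM2l.
have y2 := real_normK (num_real y).
rewrite /Y real_normK ?num_real//.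
nra.
Qed.

(** For [|v| <= u], [wsp u v] is at most the minimum of 1 and [2 u], and that minimum is at most
    [(2 u) ^ p] when [p < 1]. *)
Lemma wsp_init (p u v : R) : 0 < p < 1 -> `|v| <= u -> wsp u v <= (2 * u) `^ p.
Proof.
move=> /andP[p0 p1] vu; have u0 : 0 <= u by exact: le_trans (normr_ge0 _) vu.
have [U|U] := leP 1 (2 * u).
  rewrite (le_trans (wsp_le1 _ _ u0))// -[leLHS](powRr0 (2 * u)).
  by rewrite ler_powR// ltW.
have [uE|un0] := eqVneq u 0.
  have v0 : v = 0 by apply/normr0_eq0/le_anti; rewrite normr_ge0 andbT -uE.
  by rewrite /wsp uE v0 normr0 addr0 ltr01 mulr0 expr0n/= !addr0 subr0 powR_ge0.
have up : 0 < u by rewrite lt_neqAle eq_sym un0.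
apply: (@le_trans _ _ (2 * u)); last first.
  by rewrite ger1_powR ?(ltW p1)//; apply/andP; split; lra.
rewrite /wsp; case: ifPn => s; last by have := normr_ge0 v; lra.
have : `|v| ^+ 2 <= u ^+ 2 by rewrite ler_pXn2r ?nnegrE.
by rewrite real_normK ?num_real//; lra.
Qed.

Let lin_cond : measurable_fun [set: R * R] (fun z : R * R => z.1 + `|z.2| < 1).
Proof.
apply: measurable_fun_ltr => //; apply: measurable_funD => //.
exact: measurableT_comp.
Qed.

Lemma weak_type_small (p l : R) n : 0 < p < 1 -> 0 < l ->
  L1 (fun x => `|f 0 x| `^ p) ->
  fine (P [set x | l <= runmax g n x]) <= 2 `^ p * \int[P]_x (`|f 0 x| / l) `^ p.
Proof.
move=> /andP[p0 p1] l0 if0.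
pose Px (x y : R) := if x + `|y| < 1 then 2 - 2 * x else 0.
pose Py (x y : R) := if x + `|y| < 1 then 2 * y else 0.
(* With the constant 1 after the crossing, the stopped process dominates the indicator of the event,
   and only its initial value, a function of [f 0] and [g 0], has to be estimated. *)
pose xi (x : R) : R := 1.
pose xi' (x : R) : R := 0.
have mW : measurable_fun [set: R * R] (fun z => wsp z.1 z.2).
  apply: measurable_fun_ifT => //; apply: measurable_funB; last exact: measurable_funX.
  by apply: measurable_funD; [exact: measurable_funM|exact: measurable_funX].
have mPx : measurable_fun [set: R * R] (fun z => Px z.1 z.2).
  apply: measurable_fun_ifT => //; apply: measurable_funB => //.
  exact: measurable_funM.
have mPy : measurable_fun [set: R * R] (fun z => Py z.1 z.2).
  by apply: measurable_fun_ifT => //; exact: measurable_funM.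
have step x y h k : 0 <= x -> `|y| < 1 -> 0 <= x + h -> `|k| <= `|h| ->
    wsp (x + h) (y + k) <= wsp x y + Px x y * h + Py x y * k.
  by move=> x0 _; exact: wsp_step.
have xiP x y : 0 <= x -> 1 <= `|y| -> xi x <= wsp x y.
  by move=> x0 y1; rewrite /wsp ifF//; apply/negbTE; rewrite -leNgt -[leLHS]add0r lerD.
have xi_step x h : 0 <= x -> 0 <= x + h -> xi (x + h) <= xi x + xi' x * h.
  by rewrite /xi /xi' mul0r addr0.
have Wb x y : 0 <= x -> `|y| < 1 -> `|wsp x y| <= 1.
  by move=> x0 _; rewrite ger0_norm ?wsp_ge0// wsp_le1.
have xib x : 0 <= x -> `|xi x| <= 1 by rewrite normr1.
have iq (k : nat) : L1 (fun=> 1 : R) by exact: finite_measure_integrable_cst.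
have mxi : measurable_fun [set: R] xi by exact: measurable_cst.
have mxi' : measurable_fun [set: R] xi' by exact: measurable_cst.
have main := stopped_le0 P F f g FF Mf Mg f_ge0 dg_le wsp Px Py
  xi xi' (fun=> 1) l l0 step xiP xi_step mW mPx mPy mxi mxi' Wb xib iq n.
have iZ := stopped_integrable P F f g FF Mf Mg wsp xi (fun=> 1) l l0
  mW mxi Wb xib iq.
have if2 : L1 (fun x => 2 `^ p * (`|f 0 x| / l) `^ p).
  apply: L1Z; rewrite (_ : (fun x => _) = fun x => l^-1 `^ p * `|f 0 x| `^ p); first exact: L1Z.
  by apply/funext => x; rewrite mulrC powRM// invr_ge0 ltW.
have if1 : L1 (fun x => (`|f 0 x| / l) `^ p).
  rewrite (_ : (fun x => _) = fun x => l^-1 `^ p * `|f 0 x| `^ p); first exact: L1Z.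
  by apply/funext => x; rewrite mulrC powRM// invr_ge0 ltW.
rewrite -(Rint_indic _ (mA l n)) -RintegralZl//.
apply: (@le_trans _ _ (\int[P]_x stopped f g l n wsp xi x)).
  apply: le_Rintegral => //; first exact: L1_indic.
  move=> x _; rewrite /stopped indicE.
  have [r1|r1] := ltP (runmax g n x) l; last by rewrite mem_set.
  rewrite memNset; first by rewrite wsp_ge0// divr_ge0// ltW.
  by move=> /=; rewrite leNgt r1.
apply: (le_trans main); apply: ae_le_Rintegral => //.
apply: filterS2 (f_ge0 0) (dg_le 0) => x f0 /= dg0.
rewrite /stopped /= -powRM ?divr_ge0 ?(ltW l0)//.
have u0 : 0 <= `|f 0 x| / l by rewrite divr_ge0// ltW.
have gu : `|g 0 x / l| <= `|f 0 x| / l.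
  by rewrite normrM (gtr0_norm (_ : 0 < l^-1)) ?invr_gt0// ler_wpM2r// invr_ge0 ltW.
apply: le_trans (wsp_init p _ _ (introT andP (conj p0 p1)) gu).
case: ifPn => // gl; apply: xiP => //.
by rewrite normrM (gtr0_norm (_ : 0 < l^-1)) ?invr_gt0// ler_pdivlMr// mul1r leNgt.
Qed.

Lemma mweaknorm_small (p : R) : 0 < p < 1 ->
  (mweaknorm P p g <= 2%:E * mnorm P p f)%E.
Proof.
move=> /[dup] p01 /andP[p0 p1].
have N0 : (0 <= mnorm P p f)%E by apply: le_trans (mnorm_ge p 0); exact: poweR_ge0.
apply: mweaknorm_le => //; first by rewrite mule_ge0.
move=> l n l0.
(* For [p < 1] the moment is finite without any assumption on the norm, by [u ^ p <= 1 + u]. *)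
have if0 : L1 (fun x => `|f 0 x| `^ p).
  apply: (le_integrable measurableT _ _ (_ : L1 (fun x => 1 + `|f 0 x|))).
  - exact/measurable_EFinP.
  - move=> x _ /=; rewrite lee_fin norm_powR// normr_id [leRHS]ger0_norm ?addr_ge0//.
    have [f1|f1] := leP 1 `|f 0 x|.
      by rewrite (le_trans (ler1_powR _ (ltW p1)))// lerDr.
    have [->|fn0] := eqVneq `|f 0 x| 0; first by rewrite powR0 ?gt_eqF// addr0.
    rewrite (@le_trans _ _ 1)// ?lerDl//.
    by rewrite -[leRHS](powRr0 `|f 0 x|) ger_powR ?(ltW p0)// lt_neqAle eq_sym fn0 normr_ge0 ltW.
  - apply: L1D; first exact: finite_measure_integrable_cst.
    exact: (integrable_norm (Mf.2.1 0)).
by apply: (weak_type_mnorm p _ l 0) => //; exact: weak_type_small.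
Qed.
End small_exponent.
End weak_type_bounds.

(** * Chains killed at a random time *)

Section constant_transform.
Context {d : measure_display} {T : measurableType d} {R : realType}.
Variables (P : probability T R) (F : nat -> set (set T)).

(** Deterministic multipliers are enough for the extremal pairs. *)
Definition transform (v : nat -> R) (f : nat -> T -> R) n x : R :=
  \sum_(i < n.+1) v i * diffseq f i x.

Lemma diffseq_transform v f n x : diffseq (transform v f) n x = v n * diffseq f n x.
Proof.
case: n => [|n]; rewrite {1}/diffseq /transform; first by rewrite big_ord1.
by rewrite big_ord_recr/= addrAC subrr add0r.
Qed.

Lemma transformS v f n x :
  transform v f n.+1 x = transform v f n x + v n.+1 * (f n.+1 x - f n x).
Proof. by rewrite /transform big_ord_recr. Qed.

Lemma transform_martingale v f : filtration F -> martingale P F f ->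
  martingale P F (transform v f).
Proof.
move=> FF Mf; have [_ [mF sF]] := FF.
have if0 n : P.-integrable setT (EFin \o f n) by exact: Mf.2.1.
have ig n : P.-integrable setT (EFin \o transform v f n).
  elim: n => [|n IH].
    rewrite (_ : transform v f 0 = fun x => v 0%N * f 0%N x); first exact: L1Z.
    by apply/funext => x; rewrite /transform big_ord1.
  rewrite (_ : transform v f n.+1 = fun x => transform v f n x + v n.+1 * (f n.+1 x - f n x)).
    by apply: L1D => //; apply: L1Z; exact: L1B.
  by apply/funext => x; rewrite transformS.
have mf n : measurable_fun [set: g_sigma_algebraType (F n)] (f n).
  by apply/(measurable_wrt_sigma F FF); exact: Mf.1.
have mono n (h : T -> R) : measurable_wrt (F n) h -> measurable_wrt (F n.+1) h.
  by move=> mh B mB; apply: sF; exact: mh.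
split; last split => // n A FA.
  elim=> [|n IH].
    apply/(measurable_wrt_sigma F FF).
    rewrite (_ : transform v f 0 = fun x => v 0%N * f 0%N x); first exact: measurable_funM.
    by apply/funext => x; rewrite /transform big_ord1.
  apply/(measurable_wrt_sigma F FF).
  rewrite (_ : transform v f n.+1 = fun x => transform v f n x + v n.+1 * (f n.+1 x - f n x)).
    apply: measurable_funD; first by apply/(measurable_wrt_sigma F FF); exact: mono.
    apply: measurable_funM => //; apply: measurable_funB => //.
    by apply/(measurable_wrt_sigma F FF); apply: mono; exact: Mf.1.
  by apply/funext => x; rewrite transformS.
have mA : measurable A by exact: (mF n).
have iA (h : T -> R) : P.-integrable setT (EFin \o h) -> P.-integrable A (EFin \o h).
  by apply: integrableS.
have E (h : T -> R) : P.-integrable setT (EFin \o h) ->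
    (\int[P]_(x in A) (h x)%:E)%E = (\int[P]_(x in A) h x)%:E.
  by move=> ih; rewrite /Rintegral fineK//; apply: integrable_fin_num => //; exact: iA.
rewrite !E//; congr EFin.
under eq_Rintegral do rewrite transformS.
rewrite RintegralD//; [|exact: iA|by apply: iA; apply: L1Z; exact: L1B].
rewrite RintegralZl//; last by apply: iA; exact: L1B.
rewrite RintegralB//; [|exact: iA..].
by rewrite {2 3}/Rintegral (Mf.2.2 n A FA) subrr mulr0 addr0.
Qed.
End constant_transform.

(* The sample point [k] means that the chain is killed between times [k] and [k + 1]:
   it follows [a] up to time [k] and is frozen at [b k.+1] afterwards. The survival
   probability of the step from [n] to [n + 1] is [r n]; nothing survives step [N]. *)
Section killed_chain.
Context {R : realType}.
Variables (a b r : nat -> R) (N : nat).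
Hypothesis r01 : forall n, 0 <= r n <= 1.
Hypothesis rN : r N = 0.
Hypothesis balance : forall n, (n <= N)%N -> a n = r n * a n.+1 + (1 - r n) * b n.+1.
Hypotheses (a_ge0 : forall n, 0 <= a n) (b_ge0 : forall n, 0 <= b n).

Fixpoint surv n : R := if n is m.+1 then surv m * r m else 1.

Lemma surv_ge0 n : 0 <= surv n.
Proof. by elim: n => [//|n IH] /=; rewrite mulr_ge0//; case/andP: (r01 n). Qed.

Definition mass k : R := surv k - surv k.+1.

Lemma massE k : mass k = surv k * (1 - r k).
Proof. by rewrite /mass /=; ring. Qed.

Lemma mass_ge0 k : 0 <= mass k.
Proof. by rewrite massE mulr_ge0 ?surv_ge0// subr_ge0; case/andP: (r01 k). Qed.

Lemma sum_mass m : (m <= N)%N -> \sum_(m <= k < N.+1) mass k = surv m.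
Proof.
move=> mN; have mN' : (m <= N.+1)%N by exact: leq_trans mN _.
rewrite (eq_bigr (fun k => - (surv k.+1 - surv k))); last by move=> k _; rewrite opprB.
by rewrite sumrN telescope_sumr//= rN mulr0 sub0r opprK.
Qed.

Definition chain_measure : set nat -> \bar R :=
  msum (fun k => mscale (NngNum (mass_ge0 k)) (@dirac _ _ k R)) N.+1.

HB.instance Definition _ := Measure.on chain_measure.

Lemma ge0_chain_integral (A : set nat) (h : nat -> R) : (forall k, 0 <= h k) ->
  (\int[chain_measure]_(k in A) (h k)%:E =
   (\sum_(0 <= k < N.+1) mass k * (\1_A k * h k))%:E)%E.
Proof.
move=> h0; rewrite ge0_integral_measure_sum//; last 1 first.
  by move=> k _; rewrite lee_fin.
rewrite big_mkord -sumEFin; apply: eq_bigr => k _.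
rewrite ge0_integral_mscale//; last by move=> ? _; rewrite lee_fin.
by rewrite integral_dirac// diracE indicE -!EFinM.
Qed.

Let chain_measureT : chain_measure setT = 1%E.
Proof.
have := @ge0_chain_integral setT (fun=> 1) (fun=> ler01).
rewrite integral_cst// mul1e => ->.
rewrite (eq_bigr mass) ?sum_mass// => k _.
by rewrite indicE in_setT !mulr1.
Qed.

HB.instance Definition _ := Measure_isProbability.Build _ _ _ chain_measure chain_measureT.


Local Notation P := (chain_measure : probability _ _).

(** At time [n] the points below [n] are already killed and told apart, while [[n, oo)] is not split
    further. *)
Definition chain_filtration (n : nat) : set (set nat) :=
  [set A | forall i j, (n <= i)%N -> (n <= j)%N -> A i -> A j].

Definition chain (n k : nat) : R := if (n <= k)%N then a n else b k.+1.

Lemma chain_ge0 n k : 0 <= chain n k.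
Proof. by rewrite /chain; case: ifP. Qed.

Lemma chain_filtrationP : filtration chain_filtration.
Proof.
split; [move=> n; split|split=> [n A|n A HA i j ni nj]] => //.
- move=> A HA i j ni nj [_ Ai]; split=> // Aj.
  by apply: Ai; exact: HA Aj.
- by move=> A HA i j ni nj [m _ Ami]; exists m => //; exact: HA Ami.
- by apply: HA; exact: ltnW.
Qed.

(* The increment only charges [n, oo), on which functions measurable at time
   [n] are constant. *)
Lemma chain_increment (c : nat -> R) (phi : R -> R) n : (n <= N)%N ->
  (forall k, (n <= k)%N -> c k = c n) ->
  \sum_(0 <= k < N.+1) mass k * (c k * phi (chain n.+1 k)) =
  \sum_(0 <= k < N.+1) mass k * (c k * phi (chain n k)) +
  c n * surv n * (r n * phi (a n.+1) + (1 - r n) * phi (b n.+1) - phi (a n)).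
Proof.
move=> nN Hc; apply/eqP; rewrite addrC -subr_eq -sumrB; apply/eqP.
rewrite (@big_cat_nat _ _ _ n)//=; last exact: leq_trans nN _.
rewrite big_nat_cond big1 ?add0r; last first.
  move=> k /andP[/andP[_ kn] _].
  by rewrite /chain [(n < k)%N]ltnNge (ltnW kn)/= [(n <= k)%N]leqNgt kn/= subrr.
rewrite big_ltn ?ltnS// {1 2}/chain leqnn ltnn/=.
rewrite (_ : \sum_(n.+1 <= k < N.+1) _ =
    surv n.+1 * (c n * (phi (a n.+1) - phi (a n)))).
  by rewrite massE /=; ring.
rewrite (eq_big_nat _ _ (F2 := fun k => mass k * (c n * (phi (a n.+1) - phi (a n))))).
  rewrite -mulr_suml; congr (_ * _).
  move: nN; rewrite leq_eqVlt => /predU1P[->|nN]; last exact: sum_mass.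
  by rewrite big_geq//= rN mulr0.
move=> k /andP[nk _].
by rewrite /chain nk (ltnW nk) Hc ?(ltnW nk)//; ring.
Qed.

Lemma chain_stable (c : nat -> R) (phi : R -> R) n : (N < n)%N ->
  \sum_(0 <= k < N.+1) mass k * (c k * phi (chain n.+1 k)) =
  \sum_(0 <= k < N.+1) mass k * (c k * phi (chain n k)).
Proof.
move=> Nn; apply: eq_big_nat => k /andP[_ kN].
have kn : (k < n)%N by exact: leq_trans Nn.
by rewrite /chain [(n < k)%N]ltnNge (ltnW kn)/= [(n <= k)%N]leqNgt kn.
Qed.

Lemma chain_integrable (h : nat -> R) : P.-integrable setT (EFin \o h).
Proof.
apply/integrableP; split => //.
have -> : (\int[P]_k `|(EFin \o h) k|)%E = (\int[P]_k (`|h k|)%:E)%E by [].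
by rewrite ge0_chain_integral ?ltry.
Qed.

Lemma chain_martingale : martingale P chain_filtration chain.
Proof.
split; last split => [n|n A FA]; last 2 first.
- exact: chain_integrable.
- rewrite !ge0_chain_integral; [|exact: chain_ge0..].
  have [nN|Nn] := leqP n N; last by rewrite (chain_stable (\1_A) id).
  rewrite (chain_increment (\1_A) id)//=; last first.
    move=> k nk; rewrite !indicE; congr (nat_of_bool _)%:R.
    by apply/idP/idP; rewrite !inE; exact: FA.
  by rewrite -balance// subrr mulr0 addr0.
by move=> n B mB i j ni nj; rewrite /chain /= ni nj.
Qed.

Lemma mnorm_chain_le (p B : R) : 0 < p -> 0 <= B ->
  (forall n, \sum_(0 <= k < N.+1) mass k * (1 * chain n k `^ p) <= B) ->
  (mnorm P p chain <= (B `^ p^-1)%:E)%E.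
Proof.
move=> p0 B0 H; apply: ub_ereal_sup => _ [n _ <-].
rewrite ge0_chain_integral; last by move=> k; exact: powR_ge0.
rewrite (eq_bigr (fun k => mass k * (1 * chain n k `^ p))); last first.
  by move=> k _; rewrite indicE in_setT (ger0_norm (chain_ge0 _ _)).
rewrite poweR_EFin lee_fin; apply: ge0_ler_powR (H n); rewrite ?nnegrE//.
  by rewrite invr_ge0 ltW.
by apply: sumr_ge0 => k _; rewrite !mulr_ge0 ?mass_ge0 ?powR_ge0.
Qed.

(** If [f ^ p] decreases in mean at each step, the largest moment is the initial one. *)
Lemma chain_moment_super (p : R) : 0 < p ->
  (forall n, (n <= N)%N -> r n * a n.+1 `^ p + (1 - r n) * b n.+1 `^ p <= a n `^ p) ->
  (mnorm P p chain <= (a 0%N)%:E)%E.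
Proof.
move=> p0 H; rewrite (_ : a 0%N = (a 0%N `^ p) `^ p^-1); last first.
  by rewrite -powRrM mulfV ?gt_eqF// powRr1.
apply: mnorm_chain_le; rewrite ?powR_ge0//; elim=> [|n IH].
  rewrite (eq_bigr (fun k => mass k * a 0%N `^ p)).
    by rewrite -mulr_suml sum_mass// mul1r.
  by move=> k _; rewrite mul1r.
have [nN|Nn] := leqP n N; last by rewrite (chain_stable (fun=> 1) (fun x : R => x `^ p)).
rewrite (chain_increment (fun=> 1) (fun x : R => x `^ p))//= (le_trans _ IH)//.
by rewrite gerDl mul1r mulr_ge0_le0 ?surv_ge0// subr_le0 H.
Qed.

(** The moments increase with time, so the one at [N + 1], when all mass is killed, dominates. [h n]
    bounds its conditional mean given survival up to time [n]; summing the one-step bounds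
    telescopes to [h 0]. *)
Lemma chain_moment_sub (p : R) (h : nat -> R) : 0 < p ->
  (forall n, (n <= N)%N ->
      a n `^ p <= r n * a n.+1 `^ p + (1 - r n) * b n.+1 `^ p) ->
  (forall n, (n <= N)%N -> r n * h n.+1 + (1 - r n) * b n.+1 `^ p <= h n) ->
  (mnorm P p chain <= (h 0%N `^ p^-1)%:E)%E.
Proof.
move=> p0 Ha Hh.
pose e n := \sum_(0 <= k < N.+1) mass k * (1 * chain n k `^ p).
have e_step n : e n <= e n.+1.
  have [nN|Nn] := leqP n N; last by rewrite /e (chain_stable (fun=> 1) (fun x : R => x `^ p)).
  rewrite /e (chain_increment (fun=> 1) (fun x : R => x `^ p))//=.
  by rewrite lerDl mul1r mulr_ge0 ?surv_ge0// subr_ge0 Ha.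
have e_mono m n : (m <= n)%N -> e m <= e n.
  by move=> /subnK <-; elim: (n - m)%N => [|k IH] //; exact: le_trans (e_step _).
have eN n : e n <= e N.+1.
  have [|Nn] := leqP n N.+1; first exact: e_mono.
  rewrite -(subnK (ltnW Nn)); elim: (n - N.+1)%N => [//|k IH].
  by rewrite addSn /e (chain_stable (fun=> 1) (fun x : R => x `^ p)) ?leq_addl//; exact: IH.
have h0 : e N.+1 <= h 0%N.
  have : e N.+1 <= \sum_(0 <= k < N.+1) - (surv k.+1 * h k.+1 - surv k * h k).
    rewrite /e !big_nat; apply: ler_sum => k /andP[_ kN].
    rewrite /chain ltnNge -ltnS kN /= mul1r massE opprB -mulrA -mulrA -mulrBr ler_wpM2l ?surv_ge0//.
    by rewrite lerBrDl Hh.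
  by rewrite sumrN telescope_sumr//= rN mulr0 mul0r sub0r opprK mul1r.
apply: mnorm_chain_le => //; last by move=> n; exact: le_trans (eN n) h0.
apply: le_trans h0; apply: sumr_ge0 => k _.
by rewrite !mulr_ge0 ?mass_ge0 ?powR_ge0.
Qed.

(** The sample points [k >= m] carry total mass [surv m]. *)
Lemma mweaknorm_chain_ge (p l : R) (g : nat -> nat -> R) m :
  0 < p -> 0 < l -> (m <= N)%N ->
  (forall k, (m <= k)%N -> exists n, l <= `|g n k|) ->
  ((l * surv m `^ p^-1)%:E <= mweaknorm P p g)%E.
Proof.
move=> p0 l0 mN Hg.
apply: (@le_trans _ _ (l%:E * (P [set x | (l%:E <= maxfun g x)%E]) `^ p^-1)%E); last first.
  by apply: ereal_sup_ubound; exists l.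
set A := [set x | _].
have PA : P A = (\sum_(0 <= k < N.+1) mass k * (\1_A k * 1))%:E.
  by rewrite -ge0_chain_integral// integral_cst// mul1e.
rewrite PA poweR_EFin -EFinM lee_fin ler_pM2l//.
apply: ge0_ler_powR; rewrite ?nnegrE ?surv_ge0 ?invr_ge0 ?(ltW p0)//.
  by apply: sumr_ge0 => k _; rewrite mulr1 mulr_ge0 ?mass_ge0// indicE.
rewrite -(sum_mass m mN) (@big_cat_nat _ _ _ m 0 N.+1)//=; last exact: leqW.
rewrite -[leLHS]add0r lerD//.
  by apply: sumr_ge0 => k _; rewrite mulr1 mulr_ge0 ?mass_ge0// indicE.
rewrite le_eqVlt; apply/orP; left; apply/eqP.
apply: eq_big_nat => k /andP[mk _].
have [n ln] := Hg k mk.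
have Ak : A k.
  rewrite /A /=; apply: (@le_trans _ _ (`|g n k|)%:E); first by rewrite lee_fin.
  by apply: ereal_sup_ubound; exists n.
by rewrite indicE mem_set// !mulr1.
Qed.

Lemma chain_witness (v : nat -> R) (p c : R) : (forall n, `|v n| <= 1) ->
  (c%:E * mnorm P p chain < mweaknorm P p (transform v chain))%E ->
  exists (d : measure_display) (T : measurableType d) (Q : probability T R)
         (F : nat -> set (set T)) (f g w : nat -> T -> R),
    filtration F /\ martingale Q F f /\ martingale Q F g /\
    (forall n, {ae Q, forall x, 0 <= f n x}) /\
    predictable F w /\
    (forall n, {ae Q, forall x, `|w n x| <= 1}) /\
    (forall n, {ae Q, forall x, diffseq g n x = w n x * diffseq f n x}) /\
    (c%:E * mnorm Q p f < mweaknorm Q p g)%E.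
Proof.
move=> v1 H; exists _, nat, P, chain_filtration, chain, (transform v chain), (fun n _ => v n).
split; [exact: chain_filtrationP|split; [exact: chain_martingale|split]].
  by apply: transform_martingale; [exact: chain_filtrationP|exact: chain_martingale].
split; [by move=> n; apply/nearW => x; exact: chain_ge0|split].
  by move=> n B mB i j ni nj.
split; [by move=> n; apply/nearW|split=> //].
by move=> n; apply/nearW => x; exact: diffseq_transform.
Qed.
End killed_chain.

(** * Sharpness *)

Lemma mnorm_ge0 {d : measure_display} {T : measurableType d} {R : realType}
  (P : probability T R) (p : R) (f : nat -> T -> R) : (0 <= mnorm P p f)%E.
Proof. by apply: le_trans (mnorm_ge P f p 0); exact: poweR_ge0. Qed.

Lemma mnorm_lt_mweaknorm {d : measure_display} {T : measurableType d} {R : realType}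
  (P : probability T R) (p c B w : R) (f g : nat -> T -> R) :
  (mnorm P p f <= B%:E)%E -> (w%:E <= mweaknorm P p g)%E -> 0 < w ->
  (0 <= c -> c * B < w) -> (c%:E * mnorm P p f < mweaknorm P p g)%E.
Proof.
move=> fB wg w0 H; apply: lt_le_trans wg.
have [c0|c0] := leP 0 c.
  apply: (@le_lt_trans _ _ (c%:E * B%:E)%E); first by rewrite lee_wpmul2l.
  by rewrite -EFinM lte_fin H.
apply: (@le_lt_trans _ _ 0%E); last by rewrite lte_fin.
by rewrite mule_le0_ge0 ?mnorm_ge0// lee_fin ltW.
Qed.

(** From [1/2], [f] moves to 1 or 0, then from 1 to 2 or 0; the multipliers are 1, -1, 1. If [f]
    dies first, [g] is 1; otherwise [g] is 0 and then becomes 1 or -1. Thus [|g|] always reaches 1,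
    while the [p]-norm of [f] is at most [1/2]. *)
Lemma sharp_small (R : realType) (p c : R) : 0 < p < 1 -> c < 2 ->
  exists (d : measure_display) (T : measurableType d) (P : probability T R)
         (F : nat -> set (set T)) (f g v : nat -> T -> R),
    filtration F /\ martingale P F f /\ martingale P F g /\
    (forall n, {ae P, forall x, 0 <= f n x}) /\
    predictable F v /\
    (forall n, {ae P, forall x, `|v n x| <= 1}) /\
    (forall n, {ae P, forall x, diffseq g n x = v n x * diffseq f n x}) /\
    (c%:E * mnorm P p f < mweaknorm P p g)%E.
Proof.
move=> /andP[p0 p1] c2.
pose a (n : nat) : R := if n is n'.+1 then if n' is 0%N then 1 else 2 else 2^-1.
(* The value 2 from index 3 on freezes the survivor of both steps at its position, so its formal
   killing at [N = 2] moves nothing. *)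
pose b (n : nat) : R := if (n < 3)%N then 0 else 2.
pose r (n : nat) : R := if (n < 2)%N then 2^-1 else 0.
pose v (n : nat) : R := if n == 1%N then -1 else 1.
have r01 n : 0 <= r n <= 1 by rewrite /r; case: ifP => _; apply/andP; split; lra.
have a0 n : 0 <= a n by case: n => [|[|n]] /=; lra.
have b0 n : 0 <= b n by rewrite /b; case: ifP => _; lra.
have bal n : (n <= 2)%N -> a n = r n * a n.+1 + (1 - r n) * b n.+1.
  by case: n => [|[|[|//]]] _; rewrite /a /b /r /=; lra.
apply: (chain_witness a b r 2 r01 erefl bal a0 b0 v p c).
  by move=> n; rewrite /v; case: ifP; rewrite ?normrN normr1.
apply: (@mnorm_lt_mweaknorm _ _ _ _ _ _ (2^-1) 1) => //.
- apply: chain_moment_super => // n.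
  have h1 : 2^-1 <= (2^-1) `^ p :> R.
    by rewrite ger1_powR ?(ltW p1)//; apply/andP; split; lra.
  have h2 : 2 `^ p <= 2 :> R by rewrite ler1_powR ?(ltW p1)//; lra.
  by case: n => [|[|[|//]]] _; rewrite /a /b /r /= ?powR1 ?powR0 ?gt_eqF//; lra.
- have := @mweaknorm_chain_ge R r 2 r01 erefl p 1 (transform v (chain a b)) 0 p0 ltr01 isT.
  rewrite /= powR1 mulr1; apply => k _.
  case: k => [|[|k]].
  + exists 1%N; rewrite transformS /transform big_ord1 /chain /v /a /b /=.
    by rewrite (_ : _ + _ = 1) ?normr1//; lra.
  + exists 2%N; rewrite !transformS /transform big_ord1 /chain /v /a /b /=.
    by rewrite (_ : _ + _ = -1) ?normrN ?normr1//; lra.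
  + exists 2%N; rewrite !transformS /transform big_ord1 /chain /v /a /b /=.
    by rewrite (_ : _ + _ = 1) ?normr1//; lra.
- by move=> c0; lra.
Qed.

(** * Sharpness for large exponents *)

Lemma powR_convex_split {R : realType} (p : R) (x y z r : R) : 2 <= p ->
  0 <= r <= 1 -> 0 <= x -> 0 <= y -> 0 <= z -> x = r * y + (1 - r) * z ->
  x `^ p <= r * y `^ p + (1 - r) * z `^ p.
Proof.
move=> p2 /andP[r0 r1] x0 y0 z0 xE.
have T u : 0 <= u -> x `^ p + p * x `^ (p - 1) * (u - x) <= u `^ p.
  by move=> u0; have := @powR_tangent R p p2 x (u - x) x0; rewrite subrKC; exact.
have Y := ler_wpM2l r0 (T y y0).
have r1' : 0 <= 1 - r by lra.
have Z := ler_wpM2l r1' (T z z0).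
apply: le_trans (lerD Y Z); rewrite le_eqVlt; apply/orP; left; apply/eqP.
rewrite [X in y - X]xE [X in z - X]xE; ring.
Qed.

Lemma leq_doubleS1 k K : (k.*2.+1 <= K.*2.+2)%N = (k <= K)%N.
Proof. by lia. Qed.

Lemma leq_doubleS2 k K : (k.*2.+2 <= K.*2.+2)%N = (k <= K)%N.
Proof. by lia. Qed.

(* The chain is at [rho ^ k] on the ray at time [2 k + 1] and at the top
   [(1 + de) * rho ^ k] of an upward step at time [2 k + 2]; in the last step, from
   time [2 K + 1], survival means [f = 0] and [g = p rho ^ K]. [H k] is the mean of
   the final value of [f ^ p] given survival up to time [2 k + 1]: it solves the
   linear recursion [H_step] with the right terminal value. *)
Section ray_chain.
Context {R : realType}.
Variables (p de c : R) (K : nat).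
Hypotheses (p2 : 2 <= p) (de0 : 0 < de) (de1 : de < 1) (c0 : 0 <= c).

(** A downward step preserves [x + y = (p + 2 de) x], so it meets the ray [y = (p - 1) x] at [rho x]
    and the tangency point at [2 rho x]. [r0] and [r2] are forced by the martingale property. Per
    cycle, [q] is the probability of survival and [w] that of stopping at the tangency point. *)
Let rho := 1 + 2 * de / p.
Let r0 := p / (2 * (p - 1)).
Let r2 := (1 + 4 * de / p - de) / rho.
Let q := r2 / (1 + de).
Let w := (1 - r2) / (1 + de).
Let Rp := rho `^ p.
(** [- c1 * Rp ^ k] is a particular solution of the recursion for [H], and [D] is fixed by the
    terminal value [2 ^ p * Rp ^ K / 2], as the last step ends at [0] or [2 rho ^ K] with equal
    chances. *)
Let c1 := w * 2 `^ p * Rp / (q * Rp - 1).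
Let D := (q * Rp) ^+ K * (2 `^ p / 2 + c1).
Let H k := D * q^-1 ^+ k - c1 * Rp ^+ k.

(** [q * Rp] is the factor per cycle of the survivors' [p]-th moment; its growth eventually
    outweighs the cost [p ^ p] of the initial step. *)
Hypothesis theta1 : 1 < q * Rp.

Let a n : R := if n is n'.+1 then
    if (n <= K.*2.+1)%N then (if odd n then 1 else 1 + de) * rho ^+ n'./2 else 0
  else p / 2.
Let b n : R := if n is n'.+2 then
    if (n <= K.*2.+1)%N then if odd n then 2 * rho ^+ n./2 else 0
    else if n == K.*2.+2 then 2 * rho ^+ K else 0
  else p.
Let r n : R := if n is n'.+1 then
    if (n <= K.*2)%N then if odd n then (1 + de)^-1 else r2
    else if n == K.*2.+1 then 2^-1 else 0
  else r0.
Let v n : R := if n is n'.+1 then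
    if odd n then -1 else if (n <= K.*2.+1)%N then 1 else -1
  else 1.
Let h n : R := if n is n'.+1 then
    if (n <= K.*2.+1)%N then (if odd n then 1 else 1 + de) * H n'./2 else 0
  else r0 * H 0 + (1 - r0) * p `^ p.

Let nat_view n : n = 0%N \/ exists k, n = k.*2.+1 \/ n = k.*2.+2.
Proof.
case: n => [|n]; [by left|right; exists n./2].
by rewrite -[n in n.+1]odd_double_half; case: (odd n); [right|left]; rewrite ?add0n ?add1n.
Qed.

Let a_odd k : (k <= K)%N -> a k.*2.+1 = rho ^+ k.
Proof. by move=> kK; rewrite /a /= ltnS leq_double kK odd_double/= doubleK mul1r. Qed.

Let a_even k : (k < K)%N -> a k.*2.+2 = (1 + de) * rho ^+ k.
Proof.
by move=> kK; rewrite /a ifT; [rewrite /= odd_double/= uphalf_double|lia].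
Qed.

Let a_end : a K.*2.+2 = 0. Proof. by rewrite /a ifF//; lia. Qed.

Let b_even k : (k < K)%N -> b k.*2.+2 = 0.
Proof. by move=> kK; rewrite /b ifT; [rewrite /= odd_double|lia]. Qed.

Let b_odd k : (k < K)%N -> b k.*2.+3 = 2 * rho ^+ k.+1.
Proof.
by move=> kK; rewrite /b ifT; [rewrite /= odd_double/= uphalf_double|lia].
Qed.

Let b_end : b K.*2.+2 = 2 * rho ^+ K.
Proof. by rewrite /b ifF ?eqxx//; lia. Qed.

Let b_end1 : b K.*2.+3 = 0.
Proof. by rewrite /b ifF; [rewrite ifF//; lia|lia]. Qed.

Let r_odd k : (k < K)%N -> r k.*2.+1 = (1 + de)^-1.
Proof. by move=> kK; rewrite /r ifT; [rewrite /= odd_double|lia]. Qed.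

Let r_even k : (k < K)%N -> r k.*2.+2 = r2.
Proof. by move=> kK; rewrite /r ifT; [rewrite /= odd_double|lia]. Qed.

Let r_last : r K.*2.+1 = 2^-1.
Proof. by rewrite /r ifF ?eqxx//; lia. Qed.

Let r_end : r K.*2.+2 = 0.
Proof. by rewrite /r ifF; [rewrite ifF//; lia|lia]. Qed.

Let h_odd k : (k <= K)%N -> h k.*2.+1 = H k.
Proof. by move=> kK; rewrite /h /= ltnS leq_double kK odd_double/= doubleK mul1r. Qed.

Let h_even k : (k < K)%N -> h k.*2.+2 = (1 + de) * H k.
Proof.
by move=> kK; rewrite /h ifT; [rewrite /= odd_double/= uphalf_double|lia].
Qed.

Let h_end : h K.*2.+2 = 0. Proof. by rewrite /h ifF//; lia. Qed.

Let v_odd k : v k.*2.+1 = -1. Proof. by rewrite /v /= odd_double. Qed.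

Let v_even k : (k < K)%N -> v k.*2.+2 = 1.
Proof. by move=> kK; rewrite /v [odd _]/= odd_double/= ifT//; lia. Qed.

Let v_end : v K.*2.+2 = -1.
Proof. by rewrite /v [odd _]/= odd_double/= ifF//; lia. Qed.

Let p_gt0 : 0 < p. Proof. exact: lt_le_trans p2. Qed.
Let p_neq0 : p != 0. Proof. by rewrite gt_eqF. Qed.
Let p1_gt0 : 0 < p - 1. Proof. by have := p2; lra. Qed.
Let p1_neq0 : p - 1 != 0. Proof. by rewrite gt_eqF. Qed.
Let de1_gt0 : 0 < 1 + de. Proof. by have := de0; lra. Qed.
Let de1_neq0 : 1 + de != 0. Proof. by rewrite gt_eqF. Qed.

Let dep_ge0 : 0 <= de / p. Proof. by rewrite divr_ge0 ?ltW. Qed.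

Let rho_ge1 : 1 <= rho.
Proof. by rewrite /rho -mulrA; have := dep_ge0; lra. Qed.

Let rho_gt0 : 0 < rho. Proof. exact: lt_le_trans rho_ge1. Qed.
Let rho_neq0 : rho != 0. Proof. by rewrite gt_eqF. Qed.

Let r2_gt0 : 0 < r2.
Proof.
rewrite divr_gt0// -mulrA; have := dep_ge0; have := de1; lra.
Qed.

Let r2_le1 : r2 <= 1.
Proof.
rewrite ler_pdivrMr// mul1r /rho.
have dp : de / p <= de / 2 by rewrite ler_wpM2l ?(ltW de0)// lef_pV2 ?posrE.
by rewrite -!mulrA; lra.
Qed.

Let q_gt0 : 0 < q. Proof. by rewrite divr_gt0. Qed.
Let q_neq0 : q != 0. Proof. by rewrite gt_eqF. Qed.
Let w_ge0 : 0 <= w. Proof. by rewrite divr_ge0 ?subr_ge0// ltW. Qed.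
Let Rp_gt0 : 0 < Rp. Proof. exact: powR_gt0. Qed.
Let theta_neq0 : q * Rp - 1 != 0.
Proof. by rewrite gt_eqF// subr_gt0. Qed.
Let c1_ge0 : 0 <= c1.
Proof.
apply: divr_ge0; last by rewrite subr_ge0 ltW.
by apply: mulr_ge0; [apply: mulr_ge0 => //; exact: powR_ge0|exact: ltW].
Qed.

Let r0_01 : 0 < r0 <= 1.
Proof.
by rewrite divr_gt0 ?mulr_gt0//= ler_pdivrMr ?mulr_gt0// mul1r; have := p2; lra.
Qed.

Let rhoXp k : (rho ^+ k) `^ p = Rp ^+ k.
Proof.
elim: k => [|k IH]; first by rewrite !expr0 powR1.
by rewrite !exprS powRM ?exprn_ge0 ?(ltW rho_gt0)// IH.
Qed.

Let H_step k : q * H k.+1 + w * (2 * rho ^+ k.+1) `^ p = H k.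
Proof.
rewrite powRM ?exprn_ge0 ?(ltW rho_gt0)// rhoXp /H.
rewrite (_ : D * q^-1 ^+ k = q * (D * q^-1 ^+ k.+1)); last first.
  by rewrite exprS; field.
rewrite (_ : w * (2 `^ p * Rp ^+ k.+1) = c1 * (q * Rp - 1) * Rp ^+ k); last first.
  by rewrite /c1 divfK// exprS !mulrA.
by rewrite [Rp ^+ k.+1]exprS; ring.
Qed.

Let r01 n : 0 <= r n <= 1.
Proof.
case: n => [|n]; first by case/andP: r0_01 => [/ltW -> ->].
rewrite /r; do !case: ifP => _.
- by rewrite invr_ge0 (ltW de1_gt0)/= invf_le1// lerDl ltW.
- by rewrite (ltW r2_gt0) r2_le1.
- by apply/andP; split; lra.
- by rewrite lexx ler01.
Qed.

Let a_ge0 n : 0 <= a n.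
Proof.
case: n => [|n]; first by rewrite /a divr_ge0 ?(ltW p_gt0).
rewrite /a; do !case: ifP => // _; rewrite mulr_ge0 ?exprn_ge0 ?(ltW rho_gt0)//.
exact: ltW.
Qed.

Let b_ge0 n : 0 <= b n.
Proof.
case: n => [|[|n]]; rewrite /b ?(ltW p_gt0)//.
by do !case: ifP => // _; rewrite mulr_ge0 ?exprn_ge0 ?(ltW rho_gt0).
Qed.

Let balance n : (n <= K.*2.+2)%N -> a n = r n * a n.+1 + (1 - r n) * b n.+1.
Proof.
have [->|[k [->|->]] kK] := nat_view n.
- by move=> _; rewrite (a_odd 0)// expr0 /a /b /r /r0; field.
- move: kK; rewrite leq_doubleS1 leq_eqVlt => /predU1P[->|kK].
    by rewrite a_odd// r_last a_end b_end; field.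
  by rewrite a_odd ?(ltnW kK)// r_odd// a_even// b_even//; field.
- move: kK; rewrite leq_doubleS2 leq_eqVlt => /predU1P[->|kK].
    by rewrite a_end r_end b_end1 mul0r subr0 mulr0 addr0.
  rewrite a_even// r_even// (a_odd k.+1)// b_odd// exprS.
  have E : r2 * rho = 1 + 4 * de / p - de by rewrite /r2 divfK.
  transitivity ((2 * rho - r2 * rho) * rho ^+ k); last by ring.
  by rewrite E; congr (_ * _); rewrite /rho; ring.
Qed.

Let v_le1 n : `|v n| <= 1.
Proof.
by case: n => [|n]; rewrite /v ?normr1//; do !case: ifP => _; rewrite ?normrN normr1.
Qed.

Let surv_odd k : (k <= K)%N -> surv r k.*2.+1 = r0 * q ^+ k.
Proof.
elim: k => [_|k IH kK]; first by rewrite /= mul1r mulr1.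
rewrite doubleS -[surv _ _]/(surv r k.*2.+1 * r k.*2.+1 * r k.*2.+2).
by rewrite IH ?(ltnW kK)// r_odd// r_even// exprS /q; field.
Qed.

Let surv_end : surv r K.*2.+2 = r0 * q ^+ K / 2.
Proof. by rewrite -[surv _ _]/(surv r K.*2.+1 * r K.*2.+1) surv_odd// r_last. Qed.

Let P := chain_measure r K.*2.+2 r01.

Let chain_early n k : (n <= k)%N -> chain a b n k = a n.
Proof. by rewrite /chain => ->. Qed.

Let transform_odd k i : (k <= K)%N -> (K.*2.+2 <= i)%N ->
  transform v (chain a b) k.*2.+1 i = (p - 1) * rho ^+ k.
Proof.
move=> kK iK; elim: k kK => [_|k IH kK].
  rewrite transformS /transform big_ord1 /diffseq.
  rewrite !chain_early ?(leq_trans _ iK)// (a_odd 0)// expr0 (v_odd 0).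
  by rewrite /a /v /=; field.
have le1 : (k.*2.+1 <= i)%N by apply: leq_trans iK; rewrite leq_doubleS1 ltnW.
have le2 : (k.*2.+2 <= i)%N by apply: leq_trans iK; rewrite leq_doubleS2 ltnW.
have le3 : (k.+1.*2.+1 <= i)%N by apply: leq_trans iK; rewrite leq_doubleS1.
rewrite doubleS transformS transformS IH ?(ltnW kK)// -doubleS.
rewrite !chain_early// a_even// !a_odd ?(ltnW kK)// v_odd v_even// exprS.
by rewrite /rho; field.
Qed.

Let transform_end i : (K.*2.+2 <= i)%N ->
  transform v (chain a b) K.*2.+2 i = p * rho ^+ K.
Proof.
move=> iK; rewrite transformS transform_odd// !chain_early ?(ltnW iK)//.
by rewrite a_end a_odd// v_end; ring.
Qed.

Let cost n : (n <= K.*2.+2)%N -> r n * h n.+1 + (1 - r n) * b n.+1 `^ p <= h n.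
Proof.
have [->|[k [->|->]] kK] := nat_view n.
- by move=> _; rewrite (h_odd 0).
- move: kK; rewrite leq_doubleS1 leq_eqVlt => /predU1P[->|kK].
    rewrite h_odd// r_last h_end b_end mulr0 add0r powRM ?exprn_ge0 ?(ltW rho_gt0)//.
    rewrite rhoXp /H /D exprMn exprVn le_eqVlt; apply/orP; left; apply/eqP.
    by rewrite -/q; field; rewrite expf_neq0.
  rewrite h_odd ?(ltnW kK)// r_odd// h_even// b_even// powR0// mulr0 addr0.
  by rewrite mulrA mulVf// mul1r.
- move: kK; rewrite leq_doubleS2 leq_eqVlt => /predU1P[->|kK].
    rewrite h_end r_end b_end1 mul0r powR0// mulr0 addr0//.
  rewrite h_even// r_even// (h_odd k.+1)// b_odd// -(H_step k).
  by rewrite le_eqVlt; apply/orP; left; apply/eqP; rewrite /q /w; field.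
Qed.

(** The hypothesis compares [p]-th powers: on the left [c ^ p] times a bound for the moment of [f],
    on the right the level [p * rho ^ K] to the power [p] times the probability [r0 * q ^ K / 2] of
    reaching it. *)
Lemma ray_chain_witness :
  c `^ p * (r0 * D + p `^ p) < p `^ p * Rp ^+ K * (r0 * q ^+ K / 2) ->
  exists (d : measure_display) (T : measurableType d) (P : probability T R)
         (F : nat -> set (set T)) (f g v : nat -> T -> R),
    filtration F /\ martingale P F f /\ martingale P F g /\
    (forall n, {ae P, forall x, 0 <= f n x}) /\
    predictable F v /\
    (forall n, {ae P, forall x, `|v n x| <= 1}) /\
    (forall n, {ae P, forall x, diffseq g n x = v n x * diffseq f n x}) /\
    (c%:E * mnorm P p f < mweaknorm P p g)%E.
Proof.
move=> Hc; have /andP[r0_gt0 r0_le1] := r0_01.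
apply: (chain_witness a b r K.*2.+2 r01 r_end balance a_ge0 b_ge0 v p c v_le1).
have pr0 : 0 < p * rho ^+ K by rewrite mulr_gt0// exprn_gt0.
have S0 : 0 < surv r K.*2.+2.
  by rewrite surv_end divr_gt0// mulr_gt0// exprn_gt0.
have conv n : (n <= K.*2.+2)%N ->
    a n `^ p <= r n * a n.+1 `^ p + (1 - r n) * b n.+1 `^ p.
  by move=> nK; apply: powR_convex_split => //; exact: balance.
apply: (mnorm_lt_mweaknorm _ _ _ _ _ _ _
  (chain_moment_sub a b r _ r01 r_end a_ge0 b_ge0 p h p_gt0 conv cost)
  (mweaknorm_chain_ge r _ r01 r_end p _ (transform v (chain a b)) _ p_gt0 pr0 (leqnn _) _)).
- by move=> k Kk; exists K.*2.+2; rewrite transform_end// ger0_norm// ltW.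
- by rewrite mulr_gt0// powR_gt0.
move=> _.
have h0_le : h 0 <= r0 * D + p `^ p.
  rewrite /h /H !expr0 !mulr1 lerD//.
    by rewrite ler_wpM2l ?(ltW r0_gt0)// gerBl.
  by rewrite ler_piMl ?powR_ge0//; lra.
have h0_ge0 : 0 <= h 0.
  have t1 : 1 <= (q * Rp) ^+ K by rewrite exprn_ege1// ltW.
  have p0 : 0 <= 2 `^ p / 2 :> R by rewrite divr_ge0 ?powR_ge0.
  have D0 : c1 <= D.
    by rewrite -[leLHS]mul1r /D ler_pM// lerDr.
  rewrite /h /H !expr0 !mulr1; apply: addr_ge0; apply: mulr_ge0.
  - exact: ltW.
  - by rewrite subr_ge0.
  - by rewrite subr_ge0.
  - exact: powR_ge0.
have key : (c * h 0 `^ p^-1) `^ p < (p * rho ^+ K * surv r K.*2.+2 `^ p^-1) `^ p.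
  rewrite [ltLHS]powRM ?powR_ge0// [ltRHS]powRM ?powR_ge0 ?(ltW pr0)//.
  rewrite -!powRrM mulVf// !powRr1 ?(ltW S0)// surv_end.
  rewrite powRM ?exprn_ge0 ?(ltW rho_gt0) ?(ltW p_gt0)// rhoXp.
  by apply: le_lt_trans Hc; rewrite ler_wpM2l ?powR_ge0.
rewrite ltNge; apply/negP => le; move: key; rewrite ltNge => /negP; apply.
apply: (ge0_ler_powR (ltW p_gt0)) le; rewrite nnegrE.
  by apply: mulr_ge0; [exact: ltW|exact: powR_ge0].
by apply: mulr_ge0 => //; exact: powR_ge0.
Qed.
End ray_chain.

(** For large [K] the initial cost is negligible, and the comparison becomes
    [c ^ p * (1 + E) < (p / 2) ^ p] with [E = 2 w Rp / (q Rp - 1)]. As [de] tends to 0, [E] tends to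
    [p - 2], which yields the constant. *)
Lemma sharp_large (R : realType) (p c : R) : 2 <= p ->
  c < p / 2 * (p - 1) `^ (- p^-1) ->
  exists (d : measure_display) (T : measurableType d) (P : probability T R)
         (F : nat -> set (set T)) (f g v : nat -> T -> R),
    filtration F /\ martingale P F f /\ martingale P F g /\
    (forall n, {ae P, forall x, 0 <= f n x}) /\
    predictable F v /\
    (forall n, {ae P, forall x, `|v n x| <= 1}) /\
    (forall n, {ae P, forall x, diffseq g n x = v n x * diffseq f n x}) /\
    (c%:E * mnorm P p f < mweaknorm P p g)%E.
Proof.
move=> p2 cC.
(* For negative [c], the witness for 0 also works. *)
wlog c0 : c cC / 0 <= c => [hw|].
  have [c0|c0] := leP 0 c; first exact: hw.
  have C0 : 0 < p / 2 * (p - 1) `^ (- p^-1).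
    by rewrite mulr_gt0 ?divr_gt0 ?powR_gt0//; lra.
  have [d [T [P [F [f [g [v [h1 [h2 [h3 [h4 [h5 [h6 [h7 H]]]]]]]]]]]]]] := hw 0 C0 (lexx 0).
  exists d, T, P, F, f, g, v; do !split => //.
  by apply: le_lt_trans H; rewrite mul0e mule_le0_ge0 ?mnorm_ge0// lee_fin ltW.
have p0 : 0 < p by lra.
have pn0 : p != 0 by rewrite gt_eqF.
have p10 : 0 < p - 1 by lra.
have p1n0 : p - 1 != 0 by rewrite gt_eqF.
pose X : R := (p / 2) `^ p; pose Y := c `^ p.
have X0 : 0 < X by rewrite powR_gt0// divr_gt0.
have Y0 : 0 <= Y by exact: powR_ge0.
have YX : Y * (p - 1) < X.
  have C0 : 0 <= p / 2 * (p - 1) `^ (- p^-1).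
    by rewrite mulr_ge0 ?divr_ge0 ?powR_ge0// ltW.
  have := @gt0_ltr_powR R p p0 c _ c0 C0 cC.
  rewrite powRM ?powR_ge0 ?divr_ge0 ?(ltW p0)// -powRrM mulNr mulVf//.
  by rewrite powR_inv1 ?(ltW p10)// ltr_pdivlMr.
(* Relative error allowed on [E], small enough that [E <= (p - 2) / (1 - eta)] suffices; the cap
   [1/2] gives [1 / (1 - eta) <= 1 + 2 eta]. *)
pose eta : R := Num.min 2^-1 ((X - Y * (p - 1)) / (4 * (Y + 1) * p)).
have den0 : 0 < 4 * (Y + 1) * p by rewrite !mulr_gt0//; lra.
have eta0 : 0 < eta.
  by rewrite lt_min divr_gt0 ?subr_gt0//= andbT; lra.
have eta1 : eta <= 2^-1 by rewrite ge_min lexx.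
have eta2 : eta * (4 * (Y + 1) * p) <= X - Y * (p - 1).
  by rewrite -ler_pdivlMr// ge_min lexx orbT.
have YE : Y * (1 + (p - 2) / (1 - eta)) < X.
  have A : (p - 2) / (1 - eta) <= (p - 2) * (1 + 2 * eta).
    rewrite ler_pdivrMr; last by lra.
    rewrite -mulrA ler_peMr//; first by lra.
    by nra.
  apply: (@le_lt_trans _ _ (Y * (1 + (p - 2) * (1 + 2 * eta)))); first by rewrite ler_wpM2l// lerD2l.
  have B : 0 <= eta * Y * p by rewrite !mulr_ge0// ltW.
  have B2 : 0 < eta * p by exact: mulr_gt0.
  have B3 : 0 <= eta * Y by rewrite mulr_ge0// ltW.
  rewrite (_ : _ * _ = Y * (p - 1) + 2 * (eta * Y * p) - 4 * (eta * Y)); last by ring.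
  have E : eta * (4 * (Y + 1) * p) = 4 * (eta * Y * p) + 4 * (eta * p) by ring.
  by move: eta2; rewrite E; lra.
(* Chosen so that [1 - eta <= (1 - 2 de) (1 + de (3 - p))], the two losses that occur in the bound
   of [E]. *)
pose de : R := eta / (p + 2).
have de0 : 0 < de by rewrite divr_gt0//; lra.
have etaE : eta = (p + 2) * de by rewrite /de mulrC divfK// gt_eqF//; lra.
have de8 : de <= 8^-1.
  by rewrite /de ler_pdivrMr; lra.
have de1 : de < 1 by lra.
pose rho : R := 1 + 2 * de / p; pose r0 : R := p / (2 * (p - 1)).
pose r2 : R := (1 + 4 * de / p - de) / rho.
pose q := r2 / (1 + de); pose w := (1 - r2) / (1 + de); pose Rp := rho `^ p.
have dep0 : 0 < de / p by rewrite divr_gt0.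
have rho1 : 1 <= rho by rewrite /rho -mulrA; lra.
have rho0 : 0 < rho by lra.
have rhon0 : rho != 0 by rewrite gt_eqF.
have rhopE : rho * p = p + 2 * de by rewrite /rho; field.
have p1 : 1 <= p by lra.
have RpL : 1 + 2 * de <= Rp.
  have := bernoulli_powR p rho p1 (ltW rho0).
  by rewrite mulrBr mulr1 [p * rho]mulrC rhopE; rewrite -/Rp; lra.
(* The upper bound on [Rp] is Bernoulli's inequality at the inverse of [rho]. *)
have RpU : Rp * (1 - 2 * de) <= 1.
  have i0 : 0 <= rho^-1 by rewrite invr_ge0 ltW.
  have := bernoulli_powR p rho^-1 p1 i0.
  have -> : rho^-1 `^ p = Rp^-1.
    by rewrite -[rho^-1]powR_inv1 ?(ltW rho0)// powRAC powR_inv1// powR_ge0.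
  have H1 : 1 - 2 * de <= 1 + p * (rho^-1 - 1).
    rewrite -subr_ge0 (_ : _ - _ = 2 * de * (1 - rho^-1)); last first.
      by rewrite /rho; field; rewrite pn0 /= -rhopE mulf_neq0.
    by rewrite mulr_ge0 ?subr_ge0 ?invf_le1//; lra.
  move=> /(le_trans H1); rewrite -ler_pdivlMl ?powR_gt0//.
  by rewrite mulr1.
pose den := rho * (1 + de).
have den1 : 0 < den by rewrite mulr_gt0//; lra.
have denn0 : den != 0 by rewrite gt_eqF.
have deSn0 : 1 + de != 0 by rewrite gt_eqF//; lra.
have qE : q = (1 + 4 * de / p - de) / den.
  by rewrite /q /r2 /den invfM -[LHS]mulrA.
have wE : w = (p - 2) * (de / p) / den.
  rewrite /w /r2 /den -{1}(divff rhon0) -mulrBl invfM [RHS]mulrA.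
  by congr (_ / _ / _); rewrite /rho; field.
(* Exact numerator of [q * (1 + 2 de) - 1] over [den], hence a lower bound for [q * Rp - 1]. *)
pose t := 2 * (de / p) * (1 + de * (3 - p)).
have pde : p * de <= 2^-1 by move: eta1; rewrite etaE; lra.
have u0 : 0 < 1 + de * (3 - p) by lra.
have t0 : 0 < t by apply: mulr_gt0 => //; exact: mulr_gt0.
have q0 : 0 < q.
  by rewrite qE divr_gt0// -mulrA; lra.
have thetaL : t / den <= q * Rp - 1.
  apply: (@le_trans _ _ (q * (1 + 2 * de) - 1)); last first.
    by rewrite lerD2r ler_wpM2l// ltW.
  rewrite le_eqVlt; apply/orP; left; apply/eqP.
  transitivity (((1 + 4 * de / p - de) * (1 + 2 * de) - den) / den).
    by congr (_ / _); rewrite /t /den /rho; field.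
  by rewrite mulrBl divff// qE [in RHS]mulrAC.
have td0 : 0 < t / den by rewrite divr_gt0.
have theta1 : 1 < q * Rp by lra.
have th0 : 0 < q * Rp - 1 by lra.
have Rp0 : 0 < Rp by lra.
have Ebound : 2 * w * Rp / (q * Rp - 1) <= (p - 2) / (1 - eta).
  have e0 : 0 < 1 - eta by lra.
  rewrite ler_pdivrMr// [leRHS]mulrAC ler_pdivlMr//.
  apply: (@le_trans _ _ ((p - 2) * (t / den))); last by rewrite ler_wpM2l//; lra.
  rewrite wE (_ : 2 * _ * Rp * _ =
    (p - 2) * (2 * (de / p)) * (Rp * (1 - eta)) / den); last by ring.
  rewrite (_ : (p - 2) * (t / den) =
    (p - 2) * (2 * (de / p)) * (1 + de * (3 - p)) / den); last by rewrite /t; ring.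
  have den_ge0 : 0 <= den^-1 by rewrite invr_ge0 ltW.
  have coef_ge0 : 0 <= (p - 2) * (2 * (de / p)).
    by apply: mulr_ge0; [lra|apply: mulr_ge0 => //; exact: ltW].
  apply: ler_wpM2r => //; apply: ler_wpM2l => //.
  apply: (@le_trans _ _ (Rp * ((1 - 2 * de) * (1 + de * (3 - p))))).
    apply: ler_wpM2l; first exact: ltW.
    rewrite etaE -subr_ge0.
    rewrite (_ : _ - _ = de * (3 - 2 * de * 3 + 2 * (p * de))); last by ring.
    have pde0 : 0 < p * de by rewrite mulr_gt0.
    by apply: mulr_ge0; [exact: ltW|lra].
  by rewrite mulrA; apply: ler_piMl => //; exact: ltW.
have gap0 : 0 < X - Y * (1 + 2 * w * Rp / (q * Rp - 1)).
  rewrite subr_gt0; apply: le_lt_trans YE.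
  by rewrite ler_wpM2l// lerD2l.
have r0_gt0 : 0 < r0 by rewrite divr_gt0// mulr_gt0.
(* The powers of [q * Rp > 1] are unbounded, again by Bernoulli's inequality, so they beat the fixed
   initial cost. *)
have [K HK] : exists K : nat,
    2 * X * Y < r0 * (q * Rp) ^+ K * (X - Y * (1 + 2 * w * Rp / (q * Rp - 1))).
  set gap := X - _ in gap0 *.
  pose M := 2 * X * Y / (r0 * gap).
  pose K := (Num.trunc (M / (q * Rp - 1))).+1; exists K.
  have KM : M < K%:R * (q * Rp - 1) by rewrite -ltr_pdivrMr//; exact: truncnS_gt.
  have B : 1 + K%:R * (q * Rp - 1) <= (q * Rp) ^+ K.
    rewrite -powR_mulrn; last by lra.
    by apply: bernoulli_powR; [rewrite ler1n|lra].
  have rg0 : 0 < r0 * gap by exact: mulr_gt0.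
  have MK : M < (q * Rp) ^+ K by apply: lt_le_trans B; rewrite (lt_trans KM)// ltrDr.
  rewrite (_ : r0 * (q * Rp) ^+ K * gap = (q * Rp) ^+ K * (r0 * gap)); last first.
    by rewrite mulrAC mulrC.
  by move: MK; rewrite /M ltr_pdivrMr.
apply: (ray_chain_witness p de c K p2 de0 de1 c0 theta1).
pose Z : R := 2 `^ p.
have Z0 : 0 < Z by exact: powR_gt0.
have pp : p `^ p = Z * X.
  by rewrite /Z /X -powRM ?divr_ge0 ?(ltW p0)//; congr (_ `^ _); field.
rewrite pp -/Z -/Y -/rho -/Rp -/r0 -/r2 -/q -/w.
have th_neq0 : q * Rp - 1 != 0 by rewrite gt_eqF.
move: HK th_neq0; clear -Z0; clearbody Z X Y r0 q w Rp => HK th_neq0.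
rewrite (_ : Z * X * Rp ^+ K * (r0 * q ^+ K / 2) = Z / 2 * (r0 * (q * Rp) ^+ K * X)); last first.
  by rewrite exprMn; field.
rewrite (_ : Y * _ = Z / 2 * (2 * X * Y +
    r0 * (q * Rp) ^+ K * (Y * (1 + 2 * w * Rp / (q * Rp - 1))))); last by field.
by rewrite ltr_pM2l ?divr_gt0// -ltrBrDr -mulrBr.
Qed.

Theorem theorem1p4 (R : realType) :
  (* the two inequalities, for every filtered probability space *)
  (forall (d : measure_display) (T : measurableType d) (P : probability T R)
          (F : nat -> set (set T)) (f g : nat -> T -> R),
     filtration F -> martingale P F f -> martingale P F g ->
     (forall n, {ae P, forall x, 0 <= f n x}) ->
     (forall n, {ae P, forall x, `|diffseq g n x| <= `|diffseq f n x|}) ->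
     (forall p : R, 0 < p < 1 ->
        (mweaknorm P p g <= 2%:E * mnorm P p f)%E) /\
     (forall p : R, 2 <= p ->
        (mweaknorm P p g <= (p / 2 * (p - 1) `^ (- p^-1))%:E * mnorm P p f)%E))
  /\
  (* sharpness, already for transforms by predictable v with |v_n| <= 1 *)
  (forall p c : R, 0 < p < 1 -> c < 2 ->
     exists (d : measure_display) (T : measurableType d) (P : probability T R)
            (F : nat -> set (set T)) (f g v : nat -> T -> R),
       filtration F /\ martingale P F f /\ martingale P F g /\
           (forall n, {ae P, forall x, 0 <= f n x}) /\
           predictable F v /\
           (forall n, {ae P, forall x, `|v n x| <= 1}) /\
           (forall n, {ae P, forall x, diffseq g n x = v n x * diffseq f n x}) /\
           (c%:E * mnorm P p f < mweaknorm P p g)%E)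
  /\
  (forall p c : R, 2 <= p -> c < p / 2 * (p - 1) `^ (- p^-1) ->
     exists (d : measure_display) (T : measurableType d) (P : probability T R)
            (F : nat -> set (set T)) (f g v : nat -> T -> R),
       filtration F /\ martingale P F f /\ martingale P F g /\
           (forall n, {ae P, forall x, 0 <= f n x}) /\
           predictable F v /\
           (forall n, {ae P, forall x, `|v n x| <= 1}) /\
           (forall n, {ae P, forall x, diffseq g n x = v n x * diffseq f n x}) /\
           (c%:E * mnorm P p f < mweaknorm P p g)%E).
Proof.
split=> [d T P F f g FF Mf Mg f0 dg|].
  split=> p hp; first exact: (mweaknorm_small P F f g FF Mf Mg f0 dg p hp).
  exact: (mweaknorm_large P F f g FF Mf Mg f0 dg p hp).
by split=> p c hp hc; [exact: sharp_small hp hc|exact: sharp_large hp hc].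
Qed.
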